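(* For any $A\in{}^\imath\Xi_d$ the monomial basis element $m_A\in\mathbf S^{\jmath}$ lies in the subalgebra $\mathbf S^{\imath}$. Moreover, $\{m_A\mid A\in{}^\imath\Xi_d\}$ is an $\mathcal A$-basis of $\mathbf S^{\imath}$.
   Context: Let $\mathcal A=\mathbb Z[v,v^{-1}]$, $n,d\ge1$, $N=2n+1$, $D=2d+1$; $\mathbb N=\{0,1,2,\dots\}$, and $|U|=\dim U$. For an odd prime power $q$ equip $\mathbb F_q^D$ with a nondegenerate symmetric bilinear form with isometry group $O(D)$, and let $X$ be the set of flags $V=(0=V_0\subseteq V_1\subseteq\cdots\subseteq V_N=\mathbb F_q^D)$ with $V_i=V_{N-i}^\perp$ for all $i$. Let $\Xi_d$ be the set of $N\times N$ matrices $A=(a_{ij})$ over $\mathbb N$ with $\sum a_{ij}=D$ and $a_{ij}=a_{N+1-i,N+1-j}$. The $O(D)$-orbits $\mathcal O_A$ on $X\times X$ are indexed by $A\in\Xi_d$: $(V,V')\in\mathcal O_A$ iff $a_{ij}=|(V_{i-1}+V_i\cap V'_j)/(V_{i-1}+V_i\cap V'_{j-1})|$ for all $i,j$. $\mathbf S^{\jmath}$ is the free $\mathcal A$-module with basis $e_A$ ($A\in\Xi_d$), $e_A$ being the characteristic function of $\mathcal O_A$, with product $e_A*e_{A'}=\sum_{A''}g_{A,A',A''}e_{A''}$, where $g_{A,A',A''}\in\mathbb Z[v^2]$ is the polynomial whose value at $v=\sqrt q$, for every odd prime power $q$, is the number of $V\in X$ with $(V_1,V)\in\mathcal O_A$,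 $(V,V_2)\in\mathcal O_{A'}$, for any fixed $(V_1,V_2)\in\mathcal O_{A''}$. Standard basis: $[A]=v^{-d_A}e_A$ with $$d_A=\sum_{i>k,\,j<l,\,i+k<N+1}a_{ij}a_{kl}+\sum_{j<l,\ (i<n+1\text{ or }j<N+1-l)}a_{ij}a_{il}+\sum_{i\ge n+1>j}\frac{a_{ij}(a_{ij}-1)}2 .$$ Put $E^\theta_{ij}=E_{ij}+E_{N+1-i,N+1-j}$. For $A\in\Xi_d$, $m_A=\prod_{1\le j\le h<i\le N}[D_{i,h,j}+a_{ij}E^\theta_{h+1,h}]$, the product ($*$) taken from left to right in the order where $(i,h,j)$ precedes $(i',h',j')$ iff $i<i'$, or $i=i'$, $j<j'$, or $i=i'$, $j=j'$, $h>h'$; the $D_{i,h,j}$ are the unique diagonal matrices such that all factors lie in $\Xi_d$, the column sums of each factor equal the row sums of the next, the first factor has the row sums of $A$ and the last factor has the column sums of $A$. The $m_A$ ($A\in\Xi_d$) form an $\mathcal A$-basis of $\mathbf S^{\jmath}$. ${}^\imath\Xi_d\subset\Xi_d$ consists of the $A$ with $a_{n+1,n+1}=1$ and all other entries in row $n+1$ and column $n+1$ zero. ${}^\imath X\subset X$ is the set of flags with $V_n$ maximal isotropic; $\mathbf S^{\imath}$ is the $\mathcal A$-subalgebra of $\mathbf S^{\jmath}$ of functions supported on ${}^\imath X\times{}^\imath X$, i.e. the $\mathcal A$-span of $e_A$, $A\in{}^\imath\Xi_d$. *)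

(* Defs.v *)
From HB Require Import structures.
From mathcomp Require Import all_boot all_order all_algebra.
From mathcomp Require Import boolp classical_sets.
Set Implicit Arguments.
Unset Strict Implicit.
Unset Printing Implicit Defensive.
Import GRing.Theory.
Local Open Scope ring_scope.

(* Z[v, v^-1], realised inside the field of rational functions Q(v) as the
   subring of the fractions p / v^k with p a polynomial over Z.               *)
Definition laurent_pred : {pred {fraction {poly int}}} :=
  fun x => `[< exists (p : {poly int}) (k : nat),
                 x = tofrac p / tofrac ('X^k) >].

Lemma fractions_closed (P : comNzRingType) (K : fieldType)
    (f : {rmorphism P -> K}) (t : P) (S : {pred K}) : f t != 0 ->
  (forall x, reflect (exists p k, x = f p / f (t ^+ k)) (x \in S)) ->
  subring_closed S.
Proof.
move=> ft SP; have ftX k : f (t ^+ k) != 0 by rewrite rmorphXn expf_neq0.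
split.
- by apply/SP; exists 1, 0; rewrite expr0 rmorph1 divr1.
- move=> x y /SP[p [k ->]] /SP[q [l ->]]; apply/SP.
  exists (p * t ^+ l - q * t ^+ k), (k + l)%N.
  by rewrite -mulNr addf_div // exprD !rmorphB !rmorphM mulNr.
- move=> x y /SP[p [k ->]] /SP[q [l ->]]; apply/SP.
  by exists (p * q), (k + l)%N; rewrite exprD !rmorphM mulf_div.
Qed.

Lemma tofracX_neq0 : tofrac ('X : {poly int}) != 0.
Proof. by rewrite tofrac_eq0 polyX_eq0. Qed.

Lemma laurent_subring : subring_closed laurent_pred.
Proof.
apply: (@fractions_closed _ _ (@tofrac {poly int}) 'X _ tofracX_neq0) => x.
exact: asboolP.
Qed.
HB.instance Definition _ :=
  GRing.isSubringClosed.Build {fraction {poly int}} laurent_pred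
    laurent_subring.

Record laurent :=
  Laurent { laurent_val :> {fraction {poly int}};
            _ : laurent_val \in laurent_pred }.
HB.instance Definition _ := [isSub for laurent_val].
HB.instance Definition _ := [Choice of laurent by <:].
HB.instance Definition _ := [SubChoice_isSubComNzRing of laurent by <:].

Lemma laurent_v_subproof : tofrac 'X \in laurent_pred.
Proof. by apply/asboolP; exists 'X, 0; rewrite expr0 tofrac1 divr1. Qed.

Lemma laurent_vV_subproof : (tofrac 'X)^-1 \in laurent_pred.
Proof. by apply/asboolP; exists 1, 1; rewrite expr1 tofrac1 div1r. Qed.

Definition laurent_v : laurent := Laurent laurent_v_subproof.
Definition laurent_vV : laurent := Laurent laurent_vV_subproof.

Lemma laurent_vK : laurent_v * laurent_vV = 1.
Proof. by apply/val_inj; exact: divff tofracX_neq0. Qed.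

(* N = n.*2.+1 and D = d.*2.+1.  Rows and columns 1..N are numbered 0..N-1, so
   N+1-i becomes rev_ord i and the middle index n+1 the ordinal of value n.   *)
Definition in_Xi (n d : nat) (A : 'M[nat]_(n.*2.+1)) : bool :=
  (\sum_i \sum_j A i j == d.*2.+1)%N &&
  [forall i, forall j, A i j == A (rev_ord i) (rev_ord j)].

Record Xi (n d : nat) :=
  MkXi { Xi_mx :> 'M[nat]_(n.*2.+1); _ : in_Xi d Xi_mx }.

Section XiFinite.
Variables n d : nat.

HB.instance Definition _ := [isSub for @Xi_mx n d].
HB.instance Definition _ := [Countable of Xi n d by <:].

Definition Xi_code (A : Xi n d) : 'M['I_d.*2.+2]_(n.*2.+1) :=
  map_mx inord (Xi_mx A).

Definition Xi_decode (M : 'M['I_d.*2.+2]_(n.*2.+1)) : option (Xi n d) :=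
  insub (map_mx (@nat_of_ord _) M).

Lemma Xi_codeK : pcancel Xi_code Xi_decode.
Proof.
move=> A; rewrite /Xi_decode /Xi_code -map_mx_comp.
rewrite (_ : map_mx _ _ = Xi_mx A) ?valK //; apply/matrixP=> i j.
rewrite mxE /= inordK // ltnS; case: A => A /= /andP[/eqP<- _].
by rewrite (bigD1 i) //= (bigD1 j) //= -addnA leq_addr.
Qed.

HB.instance Definition _ : isFinite (Xi n d) := PCanIsFinite Xi_codeK.
End XiFinite.

Definition mid (n : nat) : 'I_(n.*2.+1) := inord n.

Definition iXi (n d : nat) : {set Xi n d} :=
  [set A : Xi n d | (A (mid n) (mid n) == 1%N) &&
     [forall i, (i != mid n) ==> (A (mid n) i == 0%N) && (A i (mid n) == 0%N)]].

(* The symmetric bilinear form on F^D has Gram matrix M; subspaces are row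
   spaces, each represented by its canonical generating matrix <<_>>, so that
   distinct flags are distinct subspace sequences and can be counted.         *)
Section Flags.
Variables (F : finFieldType) (n d : nat) (M : 'M[F]_(d.*2.+1)).

Definition perp (U : 'M[F]_(d.*2.+1)) : 'M[F]_(d.*2.+1) := kermx (M *m U^T).

Definition flag_type := {ffun 'I_n.*2.+2 -> 'M[F]_(d.*2.+1)}.

Definition flags : {set flag_type} :=
  [set V : flag_type |
    [&& [forall i, <<V i>>%MS == V i],
        (V ord0 == (0 : 'M[F]_(d.*2.+1)))%MS,
        (V ord_max == (1%:M : 'M[F]_(d.*2.+1)))%MS,
        [forall i : 'I_(n.*2.+1),
           (V (widen_ord (leqnSn _) i) <= V (lift ord0 i))%MS]
      & [forall i, (V i == perp (V (rev_ord i)))%MS]]].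

(* The ordinals widen_ord _ i and lift ord0 i have values i and i+1; in 1-based
   indexing these are i-1 and i.                                              *)
Definition rel_pos (V W : flag_type) : 'M[nat]_(n.*2.+1) :=
  \matrix_(i, j)
    (let U k := (V (widen_ord (leqnSn _) i) + (V (lift ord0 i) :&: W k))%MS in
     \rank (U (lift ord0 j)) - \rank (U (widen_ord (leqnSn _) j)))%N.

Definition orbit_rel (A : Xi n d) (V W : flag_type) : bool :=
  [&& V \in flags, W \in flags & rel_pos V W == Xi_mx A].
End Flags.

(* g A B C, an element of Z[v^2], is given as a polynomial in the indeterminate
   v^2, to be evaluated at q.  The condition determines g, since every C is the
   relative position of some pair of flags over every field of odd order.     *)
Definition structure_polynomials (n d : nat)
    (g : Xi n d -> Xi n d -> Xi n d -> {poly int}) : Prop :=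
  forall (A B C : Xi n d) (F : finFieldType) (M : 'M[F]_(d.*2.+1)),
    odd #|F| -> M^T = M -> M \in unitmx ->
  forall V1 V2 : flag_type F n d, orbit_rel M C V1 V2 ->
    (g A B C).[#|F|%:R]
    = #|[set V in flags n M | orbit_rel M A V1 V && orbit_rel M B V V2]|%:R.

(* Functions on the index set of the basis e_A; the pointwise product of
   {ffun _ -> _} plays no role.                                               *)
Definition Sj (n d : nat) := {ffun Xi n d -> laurent^o}.
HB.instance Definition _ n d := GRing.Lmodule.on (Sj n d).

Definition Sj_e n d (A : Xi n d) : Sj n d := [ffun B => (B == A)%:R].

Definition Sj_mul n d (g : Xi n d -> Xi n d -> Xi n d -> {poly int})
    (x y : Sj n d) : Sj n d :=
  \sum_A \sum_B (x A * y B : laurent) *: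
    \sum_C (map_poly intr (g A B C)).[laurent_v ^+ 2] *: Sj_e C.

Definition Sj_one n d : Sj n d :=
  \sum_(A : Xi n d | is_diag_mx (Xi_mx A)) Sj_e A.

(* Ordinals are shifted by one here, to match the 1-based formula for d_A.     *)
Definition d_stat n (A : 'M[nat]_(n.*2.+1)) : nat :=
  let N := n.*2.+1 in
  (\sum_(i < N) \sum_(j < N)
      \sum_(k < N | (k < i) && (i.+1 + k.+1 < N.+1)) \sum_(l < N | j < l)
        A i j * A k l
   + \sum_(i < N) \sum_(j < N)
      \sum_(l < N | (j < l) && ((i.+1 < n.+1) || (j.+1 < N.+1 - l.+1)))
        A i j * A i l
   + \sum_(i < N | n.+1 <= i.+1) \sum_(j < N | j.+1 < n.+1)
        (A i j * (A i j - 1)) %/ 2)%N.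

Definition Sj_std n d (A : Xi n d) : Sj n d :=
  (laurent_vV ^+ d_stat A) *: Sj_e A.

Definition Etheta n (i j : 'I_(n.*2.+1)) : 'M[nat]_(n.*2.+1) :=
  delta_mx i j + delta_mx (rev_ord i) (rev_ord j).

Definition row_sums n (A : 'M[nat]_(n.*2.+1)) : 'cV[nat]_(n.*2.+1) :=
  \col_i \sum_j A i j.
Definition col_sums n (A : 'M[nat]_(n.*2.+1)) : 'cV[nat]_(n.*2.+1) :=
  \col_j \sum_i A i j.

Definition triple n := ('I_(n.*2.+1) * 'I_(n.*2.+1) * 'I_(n.*2.+1))%type.

(* The triples (i, h, j) with j <= h < i, listed with i increasing, then j
   increasing, then h decreasing.                                             *)
Definition triples n : seq (triple n) :=
  let I := 'I_(n.*2.+1) in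
  flatten [seq flatten [seq [seq (i, h, j) | h : I <- rev (enum I)
                                           & (j <= h < i)%N]
                       | j : I <- enum I]
          | i : I <- enum I].

(* F (i, h, j) is the factor D_{i,h,j} + a_ij Etheta_{h+1,h}.                 *)
Definition monomial_factors n d (A : Xi n d) (F : {ffun triple n -> Xi n d}) :
    Prop :=
  [/\ forall i h j : 'I_(n.*2.+1), (j <= h < i)%N ->
        exists2 D : 'M[nat]_(n.*2.+1), is_diag_mx D &
          Xi_mx (F (i, h, j)) = D + Etheta (inord h.+1) h *+ A i j,
      sorted (fun B C : Xi n d => col_sums B == row_sums C)
        [seq F t | t <- triples n],
      row_sums (head A [seq F t | t <- triples n]) = row_sums A
    & col_sums (last A [seq F t | t <- triples n]) = col_sums A].

(* Definite description: monomial_factors determines F on triples n.          *)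
Definition the_factors n d (A : Xi n d) : {ffun triple n -> Xi n d} :=
  xget [ffun=> A] [set F | monomial_factors A F]%classic.

Definition monomial n d (g : Xi n d -> Xi n d -> Xi n d -> {poly int})
    (A : Xi n d) : Sj n d :=
  \big[Sj_mul g / Sj_one n d]_(t <- triples n) Sj_std (the_factors A t).

Definition Si n d (x : Sj n d) : Prop :=
  exists c : Xi n d -> laurent, x = \sum_(A in iXi n d) c A *: Sj_e A.

Definition basis_of_submodule (R : nzRingType) (V : lmodType R) (I : finType)
    (P : {set I}) (b : I -> V) (W : V -> Prop) : Prop :=
  [/\ forall i, i \in P -> W (b i),
      forall c : I -> R, \sum_(i in P) c i *: b i = 0 ->
        forall i, i \in P -> c i = 0
    & forall x, W x -> exists c : I -> R, x = \sum_(i in P) c i *: b i].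

(* Main.v *)
Require Import Defs.
From mathcomp Require Import all_boot all_order all_algebra.
From mathcomp Require Import perm zify.
From mathcomp Require boolp classical_sets.
Set Implicit Arguments.
Unset Strict Implicit.
Unset Printing Implicit Defensive.
Import GRing.Theory.

(* Multiplying standard basis elements counts chains of flags: up to a power of
   v, the coefficient of m_A at e_C is P_C(v^2), where P_C(q) is the number of
   chains from V to W, (V, W) in O_C, whose consecutive relative positions are
   the factors of m_A.  The factor D + a E^theta_(h+1,h) enlarges V_h inside
   V_(h+1) by a dimensions and shrinks V_(N-h) = V_h^perp accordingly.  Going
   through the factors from right to left, a chain from V to W forces
   dim (V_k cap W_l) >= sum_(i <= k, j <= l) a_ij for all k and l; when all of
   these are equalities the factor indexed by (i, h, j) must replace V_h by
   V_h + V_(h+1) cap W_j, so that there is at most one chain.  Every C in Xi_d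
   is the relative position of two flags of coordinate subspaces, for the form
   given by a permutation matrix over F_p, and moving the basis vectors one row
   at a time gives a chain between those of relative position A.  Comparing
   values at the odd primes, P_A = 1 and P_C = 0 unless A <= C in the order of
   the sums above.  Matrices comparable in this order have the same row and
   column sums, and for A in Xi_d the middle ones being 1 amounts to A being
   in iXi_d; the m_A, A in iXi_d, are thus triangular in the e_C. *)

(** * Corner sums of matrices *)

Local Open Scope ring_scope.

(** For the relative position of flags V and W this is dim (V_k cap W_l), by [rel_pos_box]. Natural
    number bounds allow k, l = 0 and m. *)
Definition box m (A : 'M[nat]_m) (k l : nat) : nat :=
  (\sum_(i < m | i < k) \sum_(j < m | j < l) A i j)%N.

Lemma sum_ord_ltS m (F : 'I_m -> nat) (k : 'I_m) :
  (\sum_(i < m | i < k.+1) F i = F k + \sum_(i < m | i < k) F i)%N.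
Proof.
rewrite (bigD1 k) //=; congr addn; apply: eq_bigl => i.
by rewrite ltnS andbC [RHS]ltn_neqAle.
Qed.

Lemma box0l m (A : 'M[nat]_m) l : box A 0 l = 0%N.
Proof. by rewrite /box big_pred0. Qed.

Lemma box0r m (A : 'M[nat]_m) k : box A k 0 = 0%N.
Proof. by rewrite /box big1 // => i _; rewrite big_pred0. Qed.

Lemma boxS m (A : 'M[nat]_m) (i : 'I_m) l :
  (box A i.+1 l = \sum_(j < m | j < l) A i j + box A i l)%N.
Proof. by rewrite /box sum_ord_ltS. Qed.

(** Inclusion-exclusion recovers an entry from four corner sums; stated without subtraction, which
    truncates on [nat]. *)
Lemma box_entry m (A : 'M[nat]_m) (i j : 'I_m) :
  (A i j + box A i j.+1 + box A i.+1 j = box A i.+1 j.+1 + box A i j)%N.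
Proof. rewrite !boxS sum_ord_ltS; lia. Qed.

Lemma box_inj m (A B : 'M[nat]_m) :
  (forall k l, k <= m -> l <= m -> box A k l = box B k l)%N -> A = B.
Proof.
move=> eqAB; apply/matrixP => i j.
have := box_entry A i j; rewrite !eqAB ?(ltnW (ltn_ord _)) //.
by rewrite -(box_entry B); lia.
Qed.

Lemma box_tot m (A : 'M[nat]_m) : box A m m = (\sum_i \sum_j A i j)%N.
Proof.
rewrite /box; apply: eq_big => [i|i _]; first by rewrite ltn_ord.
by apply: eq_bigl => j; rewrite ltn_ord.
Qed.

Lemma box_row m (A : 'M[nat]_m) k :
  box A k m = (\sum_(i < m | i < k) \sum_j A i j)%N.
Proof.
rewrite /box; apply: eq_bigr => i _.
by apply: eq_bigl => j; rewrite ltn_ord.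
Qed.

Lemma box_col m (A : 'M[nat]_m) l :
  box A m l = (\sum_(j < m | j < l) \sum_i A i j)%N.
Proof.
rewrite /box exchange_big; apply: eq_bigr => i _ /=.
by apply: eq_bigl => j; rewrite ltn_ord.
Qed.

Lemma box_compl m (A : 'M[nat]_m) k l : (k <= m)%N -> (l <= m)%N ->
  (\sum_(i < m | k <= i) \sum_(j < m | l <= j) A i j + box A k m + box A m l
   = box A m m + box A k l)%N.
Proof.
move=> km lm.
have E1 k' : box A k' m = (\sum_(i < m | i < k') \sum_(j < m | (l <= j)%N) A i
  j + box A k' l)%N.
  rewrite box_row /box -big_split; apply: eq_bigr => i _ /=.
  rewrite (bigID (fun j : 'I_m => (l <= j)%N)) /=; congr addn.
  by apply: eq_bigl => j; rewrite ltnNge.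
have E2 : (\sum_i \sum_(j < m | (l <= j)%N) A i j =
  \sum_(i < m | (k <= i)%N) \sum_(j < m | (l <= j)%N) A i j +
  \sum_(i < m | (i < k)%N) \sum_(j < m | (l <= j)%N) A i j)%N.
  rewrite (bigID (fun j : 'I_m => (k <= j)%N)) /=; congr addn.
  by apply: eq_bigl => j; rewrite ltnNge.
rewrite (E1 m) (E1 k).
have -> : (\sum_(i < m | (i < m)%N) \sum_(j < m | (l <= j)%N) A i j =
   \sum_i \sum_(j < m | (l <= j)%N) A i j)%N.
  by apply: eq_bigl => i; rewrite ltn_ord.
rewrite E2; lia.
Qed.

Lemma box_rev m (A : 'M[nat]_m) k l : (k <= m)%N -> (l <= m)%N ->
  (box (\matrix_(i, j) A (rev_ord i) (rev_ord j)) k l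
   + box A (m - k) m + box A m (m - l) = box A m m + box A (m - k) (m - l))%N.
Proof.
move=> km lm; rewrite -box_compl ?leq_subr //; congr (_ + _ + _)%N.
rewrite /box (reindex_inj rev_ord_inj) /=.
apply: eq_big => [i|i _]; first by have := ltn_ord i; lia.
rewrite (reindex_inj rev_ord_inj) /=.
apply: eq_big => [j|j _]; first by have := ltn_ord j; lia.
by rewrite mxE !rev_ordK.
Qed.

Section XiBox.
Variables n d : nat.
Local Notation N := (n.*2.+1).
Local Notation D := (d.*2.+1).

Lemma Xi_sym (A : Xi n d) i j : A (rev_ord i) (rev_ord j) = A i j.
Proof. by case: A => A /= /andP[_ /'forall_'forall_eqP]. Qed.

Lemma Xi_box_tot (A : Xi n d) : box A N N = D.
Proof. by rewrite box_tot; case: A => A /= /andP[/eqP]. Qed.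

(** The half-turn symmetry of A identifies the top left k by l corner with the opposite one, and
    inclusion-exclusion compares that with its complement. The geometric counterpart is
    [capr_dual]. *)
Lemma Xi_box_dual (A : Xi n d) k l : (k <= N)%N -> (l <= N)%N ->
  (box A (N - k) (N - l) + D = box A k l + box A (N - k) N + box A N (N - l))%N.
Proof.
move=> kN lN; rewrite -(Xi_box_tot A) addnC -box_rev //; congr (_ + _ + _)%N.
by congr box; apply/matrixP => i j; rewrite mxE Xi_sym.
Qed.

(** Since the total is fixed, inequalities between such sums at both k and N - k must be equalities;
    this is used repeatedly below. *)
Lemma Xi_box_row_dual (A : Xi n d) k : (k <= N)%N ->
  (box A (N - k) N + box A k N = D)%N.
Proof.
move=> kN; have := Xi_box_dual A kN (leqnn N); rewrite subnn !box0r; lia.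
Qed.

Lemma Xi_box_col_dual (A : Xi n d) l : (l <= N)%N ->
  (box A N (N - l) + box A N l = D)%N.
Proof.
move=> lN; have := Xi_box_dual A (leqnn N) lN; rewrite subnn !box0l; lia.
Qed.

Lemma Xi_box_inj (A B : Xi n d) :
  (forall k l, k <= N -> l <= N -> box A k l = box B k l)%N -> A = B.
Proof. by move=> /box_inj/val_inj. Qed.

End XiBox.

(** * Flags and dimensions of intersections *)

Section FlagGeometry.
Variables (F : finFieldType) (n d : nat) (M : 'M[F]_(d.*2.+1)).
Local Notation N := (n.*2.+1).
Local Notation D := (d.*2.+1).
Implicit Types (U W : 'M[F]_D) (V : flag_type F n d).

(** Indexing by natural numbers avoids ordinal casts; only k <= N is meaningful. *)
Definition part V k : 'M[F]_D := V (inord k).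

Section OneFlag.
Variable V : flag_type F n d.
Hypothesis VX : V \in flags n M.

Lemma part_genmx k : <<part V k>>%MS = part V k.
Proof.
by move: VX; rewrite inE => /and5P[/forallP/(_ (inord k))/eqP].
Qed.

Lemma part0 : part V 0 = 0.
Proof.
apply/eqP; rewrite -submx0; move: VX; rewrite inE.
by case/and5P => _ /andP[+ _] _ _ _; congr (V _ <= _)%MS; apply/val_inj;
  rewrite /= inordK.
Qed.

Lemma sub_partN U : (U <= part V N)%MS.
Proof.
apply: submx_trans (submx1 _) _; move: VX; rewrite inE.
by case/and5P => _ _ /andP[_ +] _ _; congr (_ <= V _)%MS; apply/val_inj;
  rewrite /= inordK.
Qed.

Lemma partS k : (k < N)%N -> (part V k <= part V k.+1)%MS.
Proof.
move=> kN; move: VX; rewrite inE => /and5P[_ _ _ /forallP/(_ (Ordinal kN)) + _].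
congr (V _ <= V _)%MS; apply/val_inj; rewrite /= inordK ?lift0 //.
exact: ltnW.
Qed.

Lemma part_mono k l : (k <= l <= N)%N -> (part V k <= part V l)%MS.
Proof.
elim: l => [|l IHl] /andP[kl lN]; first by case: k kl.
move: kl; rewrite leq_eqVlt ltnS => /predU1P[-> // | kl].
by apply: submx_trans (partS _) => //; rewrite IHl // kl ltnW.
Qed.

Lemma part_perp k : (k <= N)%N -> (part V (N - k) :=: perp M (part V k))%MS.
Proof.
move=> kN; move: VX; rewrite inE.
case/and5P => _ _ _ _ /forallP/(_ (inord (N - k))) /eqmxP.
by rewrite /part; congr (_ :=: perp M (V _))%MS; apply/val_inj;
  rewrite /= !inordK; lia.
Qed.

Lemma rank_partN : \rank (part V N) = D.
Proof.
by apply/eqP; rewrite eqn_leq rank_leq_row -{1}(mxrank1 F D) mxrankS ?sub_partN.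
Qed.

End OneFlag.

Lemma part_inj V (W : flag_type F n d) k : V \in flags n M -> W \in flags n M ->
  (part V k == part W k)%MS -> part V k = part W k.
Proof.
by move=> VX WX /genmxP; rewrite (part_genmx VX) (part_genmx WX).
Qed.

Definition capr (V W : flag_type F n d) k l := \rank (part V k :&: part W l)%MS.

Section TwoFlags.
Variables V W : flag_type F n d.
Hypotheses (VX : V \in flags n M) (WX : W \in flags n M).

Lemma caprN k : capr V W k N = \rank (part V k).
Proof.
apply/eqP; rewrite eqn_leq mxrankS ?capmxSl //= mxrankS // sub_capmx submx_refl.
exact: sub_partN.
Qed.

Lemma capNr l : capr V W N l = \rank (part W l).
Proof.
apply/eqP; rewrite eqn_leq mxrankS ?capmxSr //= mxrankS // sub_capmx submx_refl.
by rewrite sub_partN.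
Qed.

Lemma capr0 k : capr V W k 0 = 0%N.
Proof.
apply/eqP; rewrite -leqn0; apply: leq_trans (mxrankS (capmxSr _ _)) _.
by rewrite (part0 WX) mxrank0.
Qed.

Lemma cap0r l : capr V W 0 l = 0%N.
Proof.
apply/eqP; rewrite -leqn0; apply: leq_trans (mxrankS (capmxSl _ _)) _.
by rewrite (part0 VX) mxrank0.
Qed.

Lemma capr_mono k k' l l' : (k <= k' <= N)%N -> (l <= l' <= N)%N ->
  (capr V W k l <= capr V W k' l')%N.
Proof. by move=> kk ll;
  rewrite mxrankS // capmxS ?(part_mono VX) ?(part_mono WX). Qed.

(** The entries of a row of [rel_pos] are successive differences of the ranks of V_k + V_(k+1) cap
    W_j, so their sum telescopes; the dimension formula turns it into
    [capr V W k.+1 l - capr V W k l], which telescopes over k. *)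
Lemma rel_pos_box k l : (k <= N)%N -> (l <= N)%N ->
  box (rel_pos V W) k l = capr V W k l.
Proof.
move=> kN lN; elim: k kN => [|k IHk] kN; first by rewrite box0l cap0r.
move: IHk; set R := rel_pos V W => IHk.
rewrite (boxS R (Ordinal kN) l : box R k.+1 l = _) {IHk}(IHk (ltnW kN)).
pose U l := (part V k + (part V k.+1 :&: part W l))%MS.
(* Dimension formula for V_k and V_(k+1) cap W_l', whose intersection is V_k cap W_l'. *)
have rU l' : (l' <= N)%N ->
    (\rank (U l') + capr V W k l' = \rank (part V k) + capr V W k.+1 l')%N.
  move=> l'N; rewrite /capr -(mxrank_sum_cap (part V k)); congr addn.
  apply: eqmx_rank; apply/andP; split; rewrite !sub_capmx.
    by rewrite capmxSl capmxSr (submx_trans (capmxSl _ _)) // part_mono //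
      leqnSn.
  by rewrite capmxSl (submx_trans (capmxSr _ _)) // capmxSr.
have {}IH : (\sum_(j < N | j < l) R (Ordinal kN) j + \rank (part V k)
   = \rank (U l))%N.
  elim: l lN => [|l IHl] lN.
    rewrite big_pred0 // add0n; have := rU 0%N isT.
    by rewrite !capr0 !addn0.
  rewrite (sum_ord_ltS _ (Ordinal lN) : (\sum_(j < N | j < l.+1) _ = _)%N).
  rewrite -addnA (IHl (ltnW lN)) /R mxE.
  have -> : lift ord0 (Ordinal kN) = inord k.+1 by apply/val_inj;
    rewrite /= inordK.
  have -> : lift ord0 (Ordinal lN) = inord l.+1 by apply/val_inj;
    rewrite /= inordK.
  have -> : widen_ord (leqnSn N) (Ordinal kN) = inord k.
    by apply/val_inj; rewrite /= inordK // ltnW.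
  have -> : widen_ord (leqnSn N) (Ordinal lN) = inord l.
    by apply/val_inj; rewrite /= inordK // ltnW.
  rewrite -/(part V k) -/(part V k.+1) -/(part W l) -/(part W l.+1).
  rewrite -/(U l.+1) -/(U l).
  rewrite subnK // mxrankS // addsmxS // capmxS //.
  by rewrite part_mono // leqnSn.
have := rU _ lN; rewrite -IH; lia.
Qed.

End TwoFlags.

Lemma flag_eq (V W : flag_type F n d) : V \in flags n M -> W \in flags n M ->
  (forall k, (k <= N)%N -> part V k = part W k) -> V = W.
Proof.
move=> VX WX eqVW; apply/ffunP => k; rewrite -(inord_val k).
by apply: eqVW; rewrite -ltnS.
Qed.

(** The part of index m is the orthogonal of the part of index N - m, and N - m differs from m
    because N is odd. *)
Lemma flag_eq_except (V W : flag_type F n d) m : V \in flags n M -> W \in flags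
  n M -> (m <= N)%N ->
  (forall k, (k <= N)%N -> k != m -> part V k = part W k) -> V = W.
Proof.
move=> VX WX mN eqVW; apply: (flag_eq VX WX) => k kN.
have [->|] := eqVneq k m; last exact: eqVW.
apply: (part_inj VX WX); apply/eqmxP; rewrite -(subKn mN).
apply: eqmx_trans (part_perp VX (leq_subr m N)) _.
rewrite eqVW ?leq_subr //; last by lia.
exact/eqmx_sym/(part_perp WX (leq_subr m N)).
Qed.

Section Duality.
Hypotheses (Msym : M^T = M) (Munit : M \in unitmx).

Lemma perp_sub U W : (U <= perp M W)%MS = (W <= perp M U)%MS.
Proof.
rewrite /perp; apply/idP/idP => /sub_kermxP H; apply/sub_kermxP.
  by apply: trmx_inj; rewrite !trmx_mul trmxK Msym -mulmxA H trmx0.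
by apply: trmx_inj; rewrite !trmx_mul trmxK Msym -mulmxA H trmx0.
Qed.

Lemma rank_perp U : (\rank (perp M U) + \rank U = D)%N.
Proof.
rewrite /perp mxrank_ker eqmxMfull ?row_full_unit // mxrank_tr.
by rewrite subnK // rank_leq_row.
Qed.

Lemma rank_perp_cap U W :
  (\rank (perp M U :&: perp M W) + \rank (U + W)%MS = D)%N.
Proof.
apply: etrans (rank_perp (U + W)%MS); congr (_ + _)%N; apply: eqmx_rank.
apply/andP; split.
  rewrite perp_sub addsmx_sub; apply/andP; split; rewrite perp_sub.
    exact: capmxSl.
  exact: capmxSr.
rewrite sub_capmx; apply/andP; split; rewrite perp_sub.
  by rewrite (submx_trans (addsmxSl U W)) // perp_sub.
by rewrite (submx_trans (addsmxSr U W)) // perp_sub.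
Qed.

Lemma rank_part_dual V k : V \in flags n M -> (k <= N)%N ->
  (\rank (part V (N - k)) + \rank (part V k) = D)%N.
Proof. by move=> VX kN; rewrite (part_perp VX kN) rank_perp. Qed.

Variables V W : flag_type F n d.
Hypotheses (VX : V \in flags n M) (WX : W \in flags n M).

(** The parts of index N - k and N - l meet in the orthogonal of V_k + W_l, whose dimension is D -
    dim (V_k + W_l). *)
Lemma capr_dual k l : (k <= N)%N -> (l <= N)%N ->
  (capr V W (N - k) (N - l) + \rank (part V k) + \rank (part W l)
   = D + capr V W k l)%N.
Proof.
move=> kN lN; have := rank_perp_cap (part V k) (part W l).
rewrite -(eqmx_rank (introT eqmxP (cap_eqmx (part_perp VX kN) (part_perp WX
  lN)))).
rewrite -/(capr V W (N - k) (N - l)).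
by have := mxrank_sum_cap (part V k) (part W l); rewrite /capr; lia.
Qed.

(** By [capr_dual] the matrix and its half-turn have the same corner sums. Hence every pair of flags
    lies in some orbit, which the chain counting needs. *)
Lemma rel_pos_Xi : in_Xi d (rel_pos V W).
Proof.
have relN : box (rel_pos V W) N N = D.
  by rewrite rel_pos_box // (caprN V WX) (rank_partN VX).
apply/andP; split; first by rewrite -box_tot relN.
apply/'forall_'forall_eqP => i j.
suff E : rel_pos V W = \matrix_(i, j) rel_pos V W (rev_ord i) (rev_ord j).
  by rewrite [in LHS]E [LHS]mxE.
apply: box_inj => k l kN lN; have := box_rev (rel_pos V W) kN lN.
rewrite relN !rel_pos_box ?leq_subr // (caprN V WX) (capNr W VX).
have := capr_dual kN lN; have := rank_part_dual VX kN.
have := rank_part_dual WX lN; lia.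
Qed.

End Duality.
End FlagGeometry.

(** * Elementary steps between flags *)

Section FlagStep.
Variables (F : finFieldType) (n d : nat) (M : 'M[F]_(d.*2.+1)).
Local Notation N := (n.*2.+1).
Local Notation D := (d.*2.+1).

Section SubPart.
Variables V W : flag_type F n d.
Hypotheses (VX : V \in flags n M) (WX : W \in flags n M).

(** The vanishing entries make the k by l corner sum equal to the sum of the first k full rows, that
    is dim (V_k cap W_l) = dim V_k. *)
Lemma part_sub_rel_pos k l : (k <= N)%N -> (l <= N)%N ->
  (forall i j : 'I_N, (i < k)%N -> (l <= j)%N -> rel_pos V W i j = 0%N) ->
  (part V k <= part W l)%MS.
Proof.
move=> kN lN C0; have: capr V W k l = \rank (part V k).
  rewrite -(caprN V WX k) -!(rel_pos_box VX WX) //; apply: eq_bigr => i ik.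
  rewrite [RHS](bigID (fun j : 'I_N => j < l)%N) /= [X in (_ + X)%N]big1 ?addn0.
    by apply: eq_bigl => j; rewrite ltn_ord.
  by move=> j; rewrite -leqNgt => /andP[_ lj]; rewrite C0.
move=> /eqP; rewrite (mxrank_leqif_eq (capmxSl _ _)) => /andP[_ VVW].
exact: submx_trans VVW (capmxSr _ _).
Qed.

Lemma part_sup_rel_pos k l : (k <= N)%N -> (l <= N)%N ->
  (forall i j : 'I_N, (k <= i)%N -> (j < l)%N -> rel_pos V W i j = 0%N) ->
  (part W l <= part V k)%MS.
Proof.
move=> kN lN C0; have: capr V W k l = \rank (part W l).
  rewrite -(capNr W VX l) -!(rel_pos_box VX WX) //; rewrite /box.
  rewrite [RHS](bigID (fun i : 'I_N => i < k)%N) /= [X in (_ + X)%N]big1 ?addn0.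
    by apply: eq_bigl => j; rewrite ltn_ord.
  move=> i; rewrite -leqNgt => /andP[_ ki]; rewrite big1 // => j jl.
  by rewrite C0.
move=> /eqP; rewrite (mxrank_leqif_eq (capmxSr _ _)) => /andP[_ VVW].
exact: submx_trans VVW (capmxSl _ _).
Qed.
End SubPart.

Section Step.
Variables (V V' : flag_type F n d) (h h1 : 'I_N).
Hypotheses (VX : V \in flags n M) (V'X : V' \in flags n M).
(* Rows of matrices are numbered from 0 and h1 = h+1, so the off-diagonal
  entries
   of the relative position, (h1, h) and its mirror image, affect the parts of
   dimension index h+1 and N - (h+1) of the flag. *)
Hypothesis h1E : h1 = h.+1 :> nat.
Let hN : (h.+1 < N)%N. Proof. by rewrite -h1E. Qed.

Hypothesis C0 : forall i j : 'I_N, i != j :> nat ->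
  ~~ ((i == h1) && (j == h)) -> ~~ ((i == rev_ord h1) && (j == rev_ord h)) ->
  rel_pos V V' i j = 0%N.

(** The only entry allowed above the diagonal is the mirror one, in row N - h - 2 and column N - h -
    1; it obstructs the inclusion for a single k. *)
Lemma step_sub k : (k <= N)%N -> k != (N - h.+1)%N ->
  (part V k <= part V' k)%MS.
Proof.
move=> kN kh; apply: part_sub_rel_pos => // i j ik kj; apply: C0; first lia.
  by rewrite -!val_eqE /= ; lia.
by rewrite -!val_eqE /=; lia.
Qed.

Lemma step_sup k : (k <= N)%N -> k != h.+1 ->
  (part V' k <= part V k)%MS.
Proof.
move=> kN kh; apply: part_sup_rel_pos => // i j ik kj; apply: C0; first lia.
  by rewrite -!val_eqE /=; lia.
by rewrite -!val_eqE /=; lia.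
Qed.

Lemma step_eq k : (k <= N)%N -> k != h.+1 -> k != (N - h.+1)%N ->
  part V' k = part V k.
Proof.
by move=> kN k1 k2; apply: (part_inj V'X VX); rewrite step_sup // step_sub.
Qed.

Lemma step_supS : (part V' h.+1 <= part V h.+2)%MS.
Proof.
apply: part_sup_rel_pos => // i j ik kj.
apply: C0; first lia.
  by rewrite -!val_eqE /=; lia.
by rewrite -!val_eqE /=; lia.
Qed.

Variable a : nat.
Hypothesis Ca : rel_pos V V' h1 h = a.

(** The first h + 1 columns sum to the left side. Their first h + 1 rows contribute dim (V_(h+1) cap
    V'_(h+1)) = dim V_(h+1), and below these rows only the entry a survives. *)
Lemma step_rank : \rank (part V' h.+1) = (\rank (part V h.+1) + a)%N.
Proof.
have hN' := ltnW hN.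
have sV : (part V h.+1 <= part V' h.+1)%MS by apply: step_sub => //; lia.
have <- : capr V V' h.+1 h.+1 = \rank (part V h.+1).
  apply/eqP; rewrite /capr (mxrank_leqif_eq (capmxSl _ _)) capmxSl.
  by rewrite sub_capmx submx_refl.
rewrite -(capNr V' VX) -!(rel_pos_box VX V'X) // /box.
rewrite (bigID (fun i : 'I_N => i < h.+1)%N) /=; congr addn.
  by apply: eq_bigl => i; rewrite ltn_ord.
rewrite (bigD1 h1) /=; last by rewrite ltn_ord h1E; lia.
rewrite (bigD1 h) //= Ca [X in (a + X + _)%N]big1 => [|j /andP[jh jnh]].
  rewrite addn0 big1 ?addn0 // => i /andP[/andP[_ ih] inh]; apply: big1 => j jh.
  apply: C0; first lia.
    by rewrite (negPf inh).
  by rewrite -!val_eqE /=; lia.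
apply: C0; first by rewrite h1E; lia.
  by rewrite (negPf jnh) andbF.
by rewrite -!val_eqE /= h1E; lia.
Qed.

End Step.
End FlagStep.

(** * The index set of the monomial *)

Local Open Scope nat_scope.

Lemma pairwise_flatten_map (I T : eqType) (ltI : rel I) (r : rel T)
    (f : I -> seq T) (s : seq I) :
  (forall a, pairwise r (f a)) ->
  (forall a b x y, ltI a b -> x \in f a -> y \in f b -> r x y) ->
  pairwise ltI s -> pairwise r (flatten [seq f a | a <- s]).
Proof.
move=> rf rff; elim: s => //= a s IHs /andP[/allP la /IHs rs].
rewrite pairwise_cat rf rs !andbT; apply/allrelP => x y xa.
by case/flatten_mapP => b /la; move=> lab yb; exact: rff lab xa yb.
Qed.

Lemma pairwise_enum_ord m : pairwise (fun a b : 'I_m => a < b) (enum 'I_m).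
Proof.
rewrite -(pairwise_map (@nat_of_ord m) ltn) val_enum_ord.
by rewrite -sorted_pairwise ?iota_ltn_sorted //; exact: ltn_trans.
Qed.

Lemma pairwise_rev_enum_ord m :
  pairwise (fun a b : 'I_m => b < a) (rev (enum 'I_m)).
Proof.
rewrite -sorted_pairwise; last by move=> a b c /= ab bc; exact: ltn_trans bc ab.
rewrite rev_sorted sorted_pairwise; last by move=> a b c /=; exact: ltn_trans.
exact: pairwise_enum_ord.
Qed.

Lemma card_ord_interval m a b : b <= m -> \sum_(i < m | i < b) (a <= i) = b - a.
Proof.
elim: b => [|b IHb] bm; first by rewrite big_pred0.
rewrite (sum_ord_ltS _ (Ordinal bm) : (\sum_(i < m | i < b.+1) _ = _)%N) /=.
by rewrite (IHb (ltnW bm)); case: leqP; lia.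
Qed.

Section Triples.
Variable n : nat.
Local Notation N := (n.*2.+1).

Definition precedes (x y : triple n) : bool :=
  let: (i, h, j) := x in let: (i', h', j') := y in
  (i < i') || ((i == i') && ((j < j') || ((j == j') && (h' < h)))).

Lemma mem_triples i h j : ((i, h, j) \in triples n) = (j <= h < i).
Proof.
apply/flatten_mapP/idP =>
  [[i' _ /flatten_mapP[j' _ /mapP[h' + [-> -> ->]]]]|jhi].
  by rewrite mem_filter => /andP[].
exists i; first by rewrite mem_enum.
apply/flatten_mapP; exists j; first by rewrite mem_enum.
by apply/mapP; exists h; rewrite // mem_filter jhi mem_rev mem_enum.
Qed.

Lemma pairwise_triples : pairwise precedes (triples n).
Proof.
apply: (@pairwise_flatten_map _ _ (fun a b : 'I_N => a < b)).
- move=> i; apply: (@pairwise_flatten_map _ _ (fun a b : 'I_N => a < b)).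
  + move=> j; rewrite pairwise_map; apply: pairwise_filter.
    apply: sub_pairwise (pairwise_rev_enum_ord N) => a b /= ab.
    by rewrite !eqxx ab !orbT.
  + move=> a b x y ab /mapP[h _ ->] /mapP[h' _ ->] /=.
    by rewrite eqxx ab orbT.
  + exact: pairwise_enum_ord.
- move=> a b x y ab /flatten_mapP[j _ /mapP[h _ ->]].
  by case/flatten_mapP => j' _ /mapP[h' _ ->] /=; rewrite ab.
- exact: pairwise_enum_ord.
Qed.

Lemma precedes_irr x : precedes x x = false.
Proof. by case: x => [[i h] j] /=; rewrite !ltnn !eqxx. Qed.

Lemma uniq_triples : uniq (triples n).
Proof. by apply: pairwise_uniq pairwise_triples => x; exact: precedes_irr. Qed.

Definition moves (s : seq (triple n)) (i j : 'I_N) :=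
  count (fun t : triple n => (t.1.1 == i) && (t.2 == j)) s.

(** For fixed i and j the index h takes each value from j to i - 1 once. The case a = j counts all
    moves of a cell; since h decreases along the list, a = h + 1 counts those made before (i, h,
    j). *)
Lemma count_triples (i j : 'I_N) a : j <= a ->
  count (fun t : triple n =>
    [&& t.1.1 == i, t.2 == j & a <= t.1.2]) (triples n) = i - a.
Proof.
move=> ja; pose f (h : 'I_N) : triple n := (i, h, j).
rewrite -size_filter -(card_uniqP (filter_uniq _ uniq_triples)).
rewrite -(card_ord_interval a (ltnW (ltn_ord i))).
have f_inj : injective f by move=> x y [].
transitivity #|[pred h : 'I_N | a <= h < i]|.
  rewrite -(card_image f_inj); apply: eq_card => -[[i' h'] j'].
  rewrite mem_filter mem_triples /=; apply/idP/imageP.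
    case/andP => /and3P[/eqP-> /eqP-> ah] /andP[_ hi].
    by exists h'; rewrite // inE ah.
  case=> h; rewrite inE => /andP[ah hi] [-> -> ->].
  by rewrite !eqxx ah hi (leq_trans ja ah).
rewrite -sum1_card [LHS]big_mkcond [RHS]big_mkcond /=; apply: eq_bigr => h _.
by rewrite inE andbC; case: (h < i); case: (a <= h).
Qed.

Lemma moves_triples i j : moves (triples n) i j = i - j.
Proof.
rewrite -(count_triples i (leqnn j)); apply: eq_in_count => -[[i' h'] j'] /=.
rewrite mem_triples => /andP[jh _]; case: eqP => //= _; case: eqP => //= <-.
by rewrite jh.
Qed.

Section Prefix.
Variables s s' : seq (triple n).
Hypothesis tE : triples n = s ++ s'.

Lemma moves_le i j : moves s i j <= i - j.
Proof. by rewrite -moves_triples /moves tE count_cat leq_addr. Qed.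

End Prefix.

Section PrefixStep.
Variables (s s' : seq (triple n)) (i h j : 'I_N).
Hypothesis tE : triples n = s ++ (i, h, j) :: s'.

Lemma next_triple : j <= h < i.
Proof. by rewrite -mem_triples tE mem_cat mem_head orbT. Qed.

Lemma prefix_precedes x : x \in s -> precedes x (i, h, j).
Proof.
move=> xs; have := pairwise_triples;
  rewrite tE pairwise_cat => /and3P[/allrelP H _ _].
by apply: H; rewrite ?mem_head.
Qed.

Lemma suffix_precedes x : x \in s' -> precedes (i, h, j) x.
Proof.
move=> xs; have := pairwise_triples.
by rewrite tE pairwise_cat /= => /and3P[_ _ /andP[/allP/(_ x xs)]].
Qed.

Lemma moves_before (i' j' : 'I_N) :
  (i' < i) || ((i' == i) && (j' < j)) -> moves s i' j' = i' - j'.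
Proof.
move=> lt; rewrite -moves_triples /moves tE count_cat [X in (_ + X)%N](_ : _ =
  0) ?addn0 //.
apply/eqP; rewrite eqn0Ngt -has_count; apply/hasPn => -[[i1 h1] j1].
rewrite inE => /predU1P[[-> -> ->]|/suffix_precedes] /=.
  by move: lt; rewrite -!val_eqE /=; lia.
by move: lt; rewrite -!val_eqE /=; lia.
Qed.

Lemma moves_after (i' j' : 'I_N) :
  (i < i') || ((i' == i) && (j < j')) -> moves s i' j' = 0.
Proof.
move=> lt; apply/eqP; rewrite /moves eqn0Ngt -has_count.
apply/hasPn => -[[i1 h1] j1] /prefix_precedes /=.
by move: lt; rewrite -!val_eqE /=; lia.
Qed.

Lemma moves_current : moves s i j = i - h.+1.
Proof.
have jh : j <= h.+1 by have := next_triple; lia.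
rewrite -(count_triples i jh) tE count_cat [X in _ = (_ + X)%N](_ : _ = 0)
  ?addn0.
  apply: eq_in_count => -[[i1 h1] j1] /prefix_precedes /=.
  by rewrite -!val_eqE /=; lia.
apply/eqP; rewrite eqn0Ngt -has_count; apply/hasPn => -[[i1 h1] j1].
rewrite inE => /predU1P[[-> -> ->]|/suffix_precedes] /=.
  by rewrite -!val_eqE /=; lia.
by rewrite -!val_eqE /=; lia.
Qed.

End PrefixStep.
End Triples.

(** * Moving cells to the diagonal *)

Section Cells.
Variables n d : nat.
Local Notation N := (n.*2.+1).
Local Notation D := (d.*2.+1).
Implicit Types (f g : 'I_N -> 'I_N -> nat).

(** Assigns to each cell (i, j) a row, compatibly with the half-turn: [n.*2 - r] is the mirror of
    row r. *)
Definition placement f :=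
  (forall i j, f i j < N) /\
  (forall i j, f (rev_ord i) (rev_ord j) = n.*2 - f i j).

(** With A i j basis vectors in cell (i, j), this is the relative position of the coordinate flags
    attached to f and g ([rel_pos_coord_flag]). *)
Definition cell_count (A : 'M[nat]_N) f g : 'M[nat]_N :=
  \matrix_(k, l) \sum_i \sum_j A i j * ((f i j == k) && (g i j == l)).

Lemma sum_eq_ord m x k : x < m -> \sum_(i < m | i < k) (x == i) = (x < k).
Proof.
move=> xm; case: (ltnP x k) => xk.
  rewrite (bigD1 (Ordinal xm)) //= eqxx big1 // => i /andP[_].
  by rewrite -val_eqE /= eq_sym => /negPf ->.
by apply: big1 => i ik; apply/eqP; rewrite eqb0; lia.
Qed.

Lemma box_cell_count A f g k l :
  (forall i j, f i j < N) -> (forall i j, g i j < N) ->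
  box (cell_count A f g) k l =
  \sum_i \sum_j A i j * ((f i j < k) && (g i j < l)).
Proof.
move=> fN gN; rewrite /box /cell_count.
transitivity (\sum_(k' < N | k' < k) \sum_i \sum_j
    \sum_(l' < N | l' < l) A i j * ((f i j == k') && (g i j == l'))).
  apply: eq_bigr => k' _.
  under [LHS]eq_bigr => l' _ do rewrite mxE.
  rewrite exchange_big /=; apply: eq_bigr => i _.
  by rewrite exchange_big.
rewrite exchange_big /=; apply: eq_bigr => i _.
rewrite exchange_big /=; apply: eq_bigr => j _.
under eq_bigr => k' _ do rewrite -big_distrr /=.
rewrite -big_distrr /= -!mulnb -(sum_eq_ord k (fN i j)) -(sum_eq_ord l (gN i
  j)).
congr (_ * _); rewrite big_distrl /=; apply: eq_bigr => k' _.
by rewrite big_distrr /=; apply: eq_bigr => l' _; rewrite mulnb.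
Qed.

Lemma cell_count_Xi (A : Xi n d) f g : placement f -> placement g ->
  in_Xi d (cell_count A f g).
Proof.
move=> [fN fR] [gN gR]; apply/andP; split.
  rewrite -box_tot box_cell_count // -(Xi_box_tot A) box_tot; apply/eqP.
  by apply: eq_bigr => i _; apply: eq_bigr => j _; rewrite fN gN muln1.
apply/'forall_'forall_eqP => k l;
  rewrite !mxE [RHS](reindex_inj rev_ord_inj) /=.
apply: eq_bigr => i _; rewrite [RHS](reindex_inj rev_ord_inj) /=.
apply: eq_bigr => j _; rewrite Xi_sym fR gR; congr (_ * nat_of_bool (_ && _)).
  by have := fN i j; have := ltn_ord k; lia.
by have := gN i j; have := ltn_ord l; lia.
Qed.

Lemma row_sum_cell_count A f g k : (forall i j, g i j < N) ->
  \sum_l cell_count A f g k l = \sum_i \sum_j A i j * (f i j == k).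
Proof.
move=> gN; under eq_bigr do rewrite mxE.
rewrite exchange_big; apply: eq_bigr => i _.
rewrite exchange_big; apply: eq_bigr => j _ /=.
rewrite -big_distrr; congr (_ * _) => /=.
under eq_bigr do rewrite -mulnb.
rewrite -big_distrr /= (eq_bigl (fun l : 'I_N => l < N)) => [|l].
  by rewrite (sum_eq_ord _ (gN i j)) gN muln1.
by rewrite ltn_ord.
Qed.

Lemma col_sum_cell_count A f g l : (forall i j, f i j < N) ->
  \sum_k cell_count A f g k l = \sum_i \sum_j A i j * (g i j == l).
Proof.
move=> fN; rewrite -(row_sum_cell_count A g l fN); apply: eq_bigr => k _.
by rewrite !mxE; apply: eq_bigr => i _; apply: eq_bigr => j _; rewrite andbC.
Qed.

(* Each cell (i, j) starts in row i and ends in row j.  The triple (i, h, j)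
   moves cell (i, j) up from row h+1 to row h and, symmetrically, the cell
   (rev i, rev j) down; cur s i j is the row reached after the moves in s. *)
Definition cur (s : seq (triple n)) (i j : 'I_N) : nat :=
  if j < i then i - moves s i j else i + moves s (rev_ord i) (rev_ord j).

Section Prefix.
Variables s s' : seq (triple n).
Hypothesis tE : triples n = s ++ s'.

Lemma cur_lower (i j : 'I_N) : j <= i -> j <= cur s i j <= i.
Proof.
move=> ji; have := moves_le tE i j; have := moves_le tE (rev_ord i) (rev_ord j).
by rewrite /cur /=; case: ltnP => /=; have := ltn_ord i; lia.
Qed.

Lemma cur_upper (i j : 'I_N) : i <= j -> i <= cur s i j <= j.
Proof.
move=> ji; have := moves_le tE (rev_ord i) (rev_ord j).
by rewrite /cur /=; case: ltnP => /=; have := ltn_ord j; lia.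
Qed.

Lemma cur_placement : placement (cur s).
Proof.
split=> i j.
  have [/cur_lower|/ltnW/cur_upper] := leqP j i; have := ltn_ord i;
    have := ltn_ord j; lia.
rewrite /cur !rev_ordK /=.
have := moves_le tE i j; have := moves_le tE (rev_ord i) (rev_ord j).
have := ltn_ord i; have := ltn_ord j => /=.
case: (ltngtP i j) => ij; rewrite ?[_ - _ < _ - _](_ : _ = _).
all: by case: ifP; lia.
Qed.
End Prefix.

Lemma cur0 i j : cur [::] i j = i.
Proof. by rewrite /cur /= subn0 addn0 if_same. Qed.

Lemma cur_triples i j : cur (triples n) i j = j.
Proof.
rewrite /cur !moves_triples /=; have := ltn_ord i; have := ltn_ord j.
by case: (ltnP j i); lia.
Qed.

Section Step.
Variables (s s' : seq (triple n)) (i h j : 'I_N).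
Hypothesis tE : triples n = s ++ (i, h, j) :: s'.
Let jhi : j <= h < i := next_triple tE.

Lemma cur_current : cur s i j = h.+1.
Proof. by rewrite /cur (moves_current tE); case: ltnP; lia. Qed.

Lemma cur_before (i' j' : 'I_N) : j' < i' ->
  (i' < i) || ((i' == i) && (j' < j)) -> cur s i' j' = j'.
Proof. by move=> ji /(moves_before tE) E; rewrite /cur ji E; lia. Qed.

Lemma cur_after (i' j' : 'I_N) : j' < i' ->
  (i < i') || ((i' == i) && (j < j')) -> cur s i' j' = i'.
Proof. by move=> ji /(moves_after tE) E; rewrite /cur ji E; lia. Qed.

Lemma cur_rcons (i' j' : 'I_N) :
  cur (rcons s (i, h, j)) i' j' =
  if (i' == i) && (j' == j) then h : nat
  else if (i' == rev_ord i) && (j' == rev_ord j) then rev_ord h : nat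
  else cur s i' j'.
Proof.
have mE a b : moves (rcons s (i, h, j)) a b = moves s a b + ((i == a) && (j ==
  b)).
  by rewrite /moves -cats1 count_cat /= addn0.
rewrite /cur !mE.
have [/andP[/eqP-> /eqP->]|/negbTE ij] := boolP ((i' == i) && (j' == j)).
  by rewrite !eqxx (moves_current tE); case: ltnP; lia.
have [/andP[/eqP-> /eqP->]|/negbTE rij] :=
    boolP ((i' == rev_ord i) && (j' == rev_ord j)).
  rewrite !rev_ordK !eqxx (moves_current tE) /=.
  by have := ltn_ord i; case: (ltnP (rev_ord j) (rev_ord i)) => /=; lia.
rewrite ![i == _]eq_sym ![j == _]eq_sym ij addn0.
by rewrite !(can2_eq rev_ordK rev_ordK) rij addn0.
Qed.

End Step.
End Cells.

(** * The factors of the monomial *)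

Lemma sum2_delta m (G : 'I_m -> 'I_m -> nat) a b :
  \sum_i \sum_j G i j * ((i == a) && (j == b)) = G a b.
Proof.
rewrite (bigD1 a) //= (bigD1 b) //= !eqxx muln1 !big1 ?addn0 //.
  by move=> i /negPf ia; apply: big1 => j _; rewrite ia muln0.
by move=> j /negPf jb; rewrite jb muln0.
Qed.

Section Factors.
Variables n d : nat.
Local Notation N := (n.*2.+1).
Local Notation D := (d.*2.+1).
Variable A : Xi n d.

(** The placement before the first move ([cur0]); [cell_col] is the one after the last
    ([cur_triples]). *)
Definition cell_row (i j : 'I_N) : nat := i.
Definition cell_col (i j : 'I_N) : nat := j.

Lemma cell_row_placement : placement cell_row.
Proof. by split=> i j; rewrite /cell_row. Qed.

Lemma cell_col_placement : placement cell_col.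
Proof. by split=> i j; rewrite /cell_col. Qed.

Lemma cell_count_id (B : 'M[nat]_N) : cell_count B cell_row cell_col = B.
Proof.
apply/matrixP => k l; rewrite mxE -[RHS](sum2_delta (fun i j => B i j) k l).
by apply: eq_bigr => i _; apply: eq_bigr => j _; rewrite -!val_eqE.
Qed.

Lemma row_sums_cell_count (f g : 'I_N -> 'I_N -> nat) g' :
  (forall i j, g i j < N) -> (forall i j, g' i j < N) ->
  row_sums (cell_count A f g) = row_sums (cell_count A f g').
Proof.
by move=> gN g'N; apply/matrixP => k l; rewrite !mxE !row_sum_cell_count.
Qed.

Lemma col_sums_cell_count (f g : 'I_N -> 'I_N -> nat) g' :
  (forall i j, f i j < N) -> (forall i j, g' i j < N) ->
  col_sums (cell_count A f g) = row_sums (cell_count A g g').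
Proof.
move=> gN g'N; apply/matrixP => k l.
by rewrite [LHS]mxE [RHS]mxE row_sum_cell_count // col_sum_cell_count.
Qed.

(* state A s is the relative position of the current flag and the last one,
   factor A s t that of the current flag and the next one. *)
Definition state s : 'M[nat]_N := cell_count A (cur s) cell_col.
Definition factor s t : 'M[nat]_N := cell_count A (cur s) (cur (rcons s t)).

Lemma state0 : state [::] = A.
Proof.
rewrite -[RHS]cell_count_id; apply/matrixP => k l; rewrite !mxE.
by apply: eq_bigr => i _; apply: eq_bigr => j _; rewrite cur0.
Qed.

Lemma state_Xi s s' : triples n = s ++ s' -> in_Xi d (state s).
Proof.
by move=> tE; apply: cell_count_Xi (cur_placement tE) cell_col_placement.
Qed.

Lemma factor_Xi s t s' : triples n = s ++ t :: s' -> in_Xi d (factor s t).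
Proof.
move=> tE; apply: cell_count_Xi; first exact: cur_placement tE.
by apply: (cur_placement (s' := s')); rewrite cat_rcons.
Qed.

Section Step.
Variables (s s' : seq (triple n)) (i h j : 'I_N).
Hypothesis tE : triples n = s ++ (i, h, j) :: s'.
Local Notation t := (i, h, j).
Let jhi : j <= h < i := next_triple tE.
Let h1 : 'I_N := inord h.+1.

Lemma inord_next : h1 = h.+1 :> nat.
Proof. by rewrite inordK //; have := ltn_ord i; lia. Qed.

Let tE' : triples n = rcons s t ++ s'. Proof. by rewrite cat_rcons. Qed.

Lemma box_state k l : box (state s) k l =
  \sum_i' \sum_j' A i' j' * ((cur s i' j' < k) && (j' < l)).
Proof.
by rewrite box_cell_count //;
  [case: (cur_placement tE)|case: cell_col_placement].
Qed.

Lemma box_state_rcons k l : box (state (rcons s t)) k l =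
  \sum_i' \sum_j' A i' j' * ((cur (rcons s t) i' j' < k) && (j' < l)).
Proof.
by rewrite box_cell_count //;
  [case: (cur_placement tE')|case: cell_col_placement].
Qed.

Lemma cur_mirror : cur s (rev_ord i) (rev_ord j) = n.*2 - h.+1.
Proof. by rewrite (cur_placement tE).2 (cur_current tE). Qed.

(** Moving cell (i, j) from row h + 1 to row h crosses only the boundary k = h + 1, and its mirror
    crosses only k = N - (h + 1). *)
Lemma box_state_step_other k l : k != h.+1 -> k != N - h.+1 ->
  box (state (rcons s t)) k l = box (state s) k l.
Proof.
move=> k1 k2; rewrite box_state box_state_rcons.
apply: eq_bigr => i' _; apply: eq_bigr => j' _;
  congr (_ * nat_of_bool (_ && _)).
rewrite (cur_rcons tE); case: ifP => [/andP[/eqP-> /eqP->]|_].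
  by rewrite (cur_current tE); lia.
case: ifP => [/andP[/eqP-> /eqP->]|_] //.
by rewrite cur_mirror /=; have := ltn_ord i; lia.
Qed.

Lemma box_state_step l :
  box (state (rcons s t)) h.+1 l = box (state s) h.+1 l + A i j * (j < l).
Proof.
rewrite box_state box_state_rcons.
rewrite -(sum2_delta (fun i j => A i j * (j < l)) i j) -big_split.
apply: eq_bigr => i' _; rewrite -big_split; apply: eq_bigr => j' _ /=.
rewrite (cur_rcons tE); case: ifP => [/andP[/eqP-> /eqP->]|_].
  by rewrite (cur_current tE) ltnn ltnSn muln0 muln1.
rewrite muln0 addn0; case: ifP => [/andP[/eqP-> /eqP->]|_] //.
rewrite cur_mirror /=; congr (_ * nat_of_bool (_ && _)).
by have := ltn_ord i; lia.
Qed.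

(** Row h holds no cell of a column j' < j: such cells either have reached row j' < h, or have i' >
    i and still wait in row i', or started on or above the diagonal and lie in rows at most j'. *)
Lemma box_state_rcons_below l : l <= j ->
  box (state (rcons s t)) h.+1 l = box (state (rcons s t)) h l.
Proof.
move=> lj; rewrite !box_state_rcons.
apply: eq_bigr => i' _; apply: eq_bigr => j' _; case: (ltnP j' l) => jl;
  last by rewrite !andbF.
rewrite !andbT; congr (_ * nat_of_bool _).
suff : cur (rcons s t) i' j' != h by lia.
rewrite (cur_rcons tE); case: ifP => [/andP[/eqP ii /eqP jj]|ne].
  by move: jl; rewrite jj; lia.
case: ifP => [/andP[/eqP ii /eqP jj]|_].
  by move: jl; rewrite jj /=; have := ltn_ord i; lia.
have [ij|ij] := ltnP j' i'; last by have := cur_upper tE ij; lia.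
have [ii|ii] := ltnP i i'; first by rewrite (cur_after tE ij) ?ii //; lia.
rewrite (cur_before tE ij); first lia.
by rewrite -val_eqE /=; lia.
Qed.

Lemma cur_next_row (i' j' : 'I_N) : j' <= j ->
  (cur s i' j' == h.+1) = (i' == i) && (j' == j).
Proof.
move=> j'j; apply/eqP/andP => [|[/eqP-> /eqP->]]; last exact: cur_current tE.
move=> c; have [ij|ij] := ltnP j' i'; last by have := cur_upper tE ij; lia.
have [ii|ii] := ltnP i i'.
  by move: c; rewrite (cur_after tE ij) ?ii //; lia.
have [b|b] := boolP ((i' < i) || ((i' == i) && (j' < j))).
  by move: c; rewrite (cur_before tE ij b); lia.
by move: b; rewrite -!val_eqE /=; lia.
Qed.

(** Among columns up to j, row h + 1 contains only the cell about to be moved ([cur_next_row]). *)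
Lemma box_state_next l : l <= j.+1 ->
  box (state s) h.+2 l = box (state s) h.+1 l + A i j * (j < l).
Proof.
move=> lj; rewrite !box_state.
rewrite -(sum2_delta (fun i j => A i j * (j < l)) i j) -big_split.
apply: eq_bigr => i' _; rewrite -big_split; apply: eq_bigr => j' _ /=.
case: (ltnP j' l) => jl; last by rewrite !andbF !muln0.
rewrite !andbT !muln1 -cur_next_row; last lia.
by case: (ltngtP (cur s i' j') h.+1) => c; rewrite ?muln0 ?muln1; lia.
Qed.

Lemma factor_offdiag (k l : 'I_N) : k != l ->
  factor s t k l = A i j * ((k == h1) && (l == h)) +
     A i j * ((k == rev_ord h1) && (l == rev_ord h)).
Proof.
move=> kl; rewrite mxE -[in X in _ + X](Xi_sym A).
rewrite -(sum2_delta (fun i j => A i j * ((k == h1) && (l == h))) i j).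
rewrite -(sum2_delta (fun i j =>
  A i j * ((k == rev_ord h1) && (l == rev_ord h)))
  (rev_ord i) (rev_ord j)) -big_split.
apply: eq_bigr => i' _; rewrite -big_split; apply: eq_bigr => j' _ /=.
rewrite (cur_rcons tE); case: ifP => [/andP[/eqP-> /eqP->]|_].
  rewrite [X in _ + _ * nat_of_bool X](_ : _ = false).
    by rewrite muln0 addn0 muln1 (cur_current tE) -!val_eqE /= inord_next
      !(eq_sym (nat_of_ord _) h.+1) (eq_sym (nat_of_ord h)).
  by rewrite -!val_eqE /=; have := ltn_ord i; lia.
case: ifP => [/andP[/eqP-> /eqP->]|_].
  rewrite muln0 add0n muln1 cur_mirror -!val_eqE /= inord_next.
  by congr (_ * nat_of_bool (_ && _)); rewrite eq_sym; have := ltn_ord i; lia.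
rewrite !muln0; case: eqP => [ck|_]; last by rewrite muln0.
by case: eqP => [cl|_]; rewrite ?muln0 //; move: kl;
  rewrite -val_eqE /= -ck -cl eqxx.
Qed.

Lemma factor_offdiag0 (k l : 'I_N) : k != l :> nat ->
  ~~ ((k == h1) && (l == h)) -> ~~ ((k == rev_ord h1) && (l == rev_ord h)) ->
  factor s t k l = 0.
Proof.
by move=> kl /negPf n1 /negPf n2; rewrite factor_offdiag // n1 n2 !muln0.
Qed.

Lemma factor_entry : factor s t h1 h = A i j.
Proof.
have hh : h1 != h by rewrite -val_eqE /= inord_next; lia.
rewrite factor_offdiag // !eqxx muln1 [X in _ + _ * nat_of_bool X](_ : _ =
  false).
  by rewrite muln0 addn0.
by rewrite -!val_eqE /= inord_next; have := ltn_ord i; lia.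
Qed.

Lemma mx_natE (B : 'M[nat]_N) a k l : (B *+ a)%R k l = B k l * a.
Proof. by elim: a => [|a IHa];
  rewrite ?mulr0n ?mxE ?muln0 // mulrS mxE IHa mulnS. Qed.

Lemma EthetaE (k l : 'I_N) : (Etheta h1 h *+ A i j)%R k l =
  A i j * ((k == h1) && (l == h)) +
     A i j * ((k == rev_ord h1) && (l == rev_ord h)).
Proof.
by rewrite mx_natE !mxE -mulnDr mulnC; congr (_ * (_ + _)); case: (_ && _).
Qed.

Lemma factor_decomposition : exists2 E : 'M[nat]_N, is_diag_mx E &
  factor s t = (E + Etheta h1 h *+ A i j)%R.
Proof.
exists (\matrix_(k, l) if k == l then factor s t k l else 0)%R.
  by apply/is_diag_mxP => k l kl; rewrite mxE (negPf (_ : k != l)).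
apply/matrixP => k l; rewrite [RHS]mxE EthetaE [X in _ = (X + _)%R]mxE.
case: eqVneq => [->|kl]; last by rewrite (factor_offdiag kl).
rewrite [X in (_ * nat_of_bool X) + _](_ : _ = false).
  rewrite [X in _ + (_ * nat_of_bool X)](_ : _ = false);
    first by rewrite muln0; exact/esym/addn0.
  by rewrite -!val_eqE /= inord_next; have := ltn_ord i; lia.
by rewrite -!val_eqE /= inord_next; lia.
Qed.

(** The shape fixes the off-diagonal entries, after which each diagonal entry is determined by its
    row sum. *)
Lemma factor_unique (X E : 'M[nat]_N) : is_diag_mx E ->
  X = (E + Etheta h1 h *+ A i j)%R -> row_sums X = row_sums (state s) ->
  X = factor s t.
Proof.
move=> /is_diag_mxP dE XE rX.
have offd k l : k != l -> X k l = factor s t k l.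
  move=> kl; rewrite (factor_offdiag kl) XE mxE EthetaE dE //.
have rr : row_sums X = row_sums (factor s t).
  rewrite rX; apply: row_sums_cell_count; first by case: cell_col_placement.
  by case: (cur_placement tE').
apply/matrixP => k l; have [<-|] := eqVneq k l; last exact: offd.
have /matrixP/(_ k ord0) := rr;
  rewrite [LHS]mxE [RHS]mxE (bigD1 k) //= [RHS](bigD1 k) //=.
rewrite [X in _ = _ + X](eq_bigr (fun l => X k l)) => [/addIn //|j' jk].
by symmetry; apply: offd; rewrite eq_sym.
Qed.

End Step.
End Factors.

Lemma sorted_consecutive (T : Type) (e : rel T) (s : seq T) :
  (forall s1 x y s2, s = s1 ++ [:: x, y & s2] -> e x y) -> sorted e s.
Proof.
elim: s => // x [//|y s] IHs H /=; rewrite (H [::] x y s) //=.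
by apply: IHs => s1 a b s2 E; apply: (H (x :: s1) a b s2); rewrite E.
Qed.

(** * Existence and uniqueness of the factors *)

Section MonomialFactors.
Variables n d : nat.
Local Notation N := (n.*2.+1).
Variable A : Xi n d.

Lemma col_sums_factor s t s' : triples n = s ++ t :: s' ->
  col_sums (factor A s t) = row_sums (state A (rcons s t)).
Proof.
move=> tE; have tE' : triples n = rcons s t ++ s' by rewrite cat_rcons.
apply: col_sums_cell_count; first by case: (cur_placement tE).
by case: (@cell_col_placement n).
Qed.

Lemma row_sums_factor s t s' : triples n = s ++ t :: s' ->
  row_sums (factor A s t) = row_sums (state A s).
Proof.
move=> tE; have tE' : triples n = rcons s t ++ s' by rewrite cat_rcons.
apply: row_sums_cell_count; first by case: (cur_placement tE').
by case: (@cell_col_placement n).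
Qed.

Lemma row_sums_state_triples :
  row_sums (state A (triples n)) = col_sums A.
Proof.
rewrite -[in RHS](cell_count_id A); symmetry.
rewrite (@col_sums_cell_count _ _ A _ _ (@cell_col n)).
- congr row_sums; apply/matrixP => k l; rewrite !mxE.
  by apply: eq_bigr => i _; apply: eq_bigr => j _; rewrite cur_triples.
- by case: (@cell_row_placement n).
- by case: (@cell_col_placement n).
Qed.

(** Induction from the left: the row sums of the first factor are those of A, and each factor passes
    its column sums on to the next, so that [factor_unique] applies at every place. *)
Lemma factors_eq (F : {ffun triple n -> Xi n d}) s t s' :
  monomial_factors A F -> triples n = s ++ t :: s' ->
  Xi_mx (F t) = factor A s t.
Proof.
case=> Fdiag Fsorted Fhead _ tE.
suff rF : row_sums (F t) = row_sums (state A s).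
  case: t => -[i h] j in tE rF *.
  have [E Ediag FE] := Fdiag i h j (next_triple tE).
  exact: (factor_unique tE Ediag FE rF).
elim/last_ind: s => [|s t0 IHs] in t s' tE *.
  by move: Fhead; rewrite state0 tE.
have tE0 : triples n = s ++ t0 :: t :: s' by rewrite tE cat_rcons.
rewrite -(col_sums_factor tE0).
have <- : Xi_mx (F t0) = factor A s t0.
  case: t0 => -[i h] j in tE0 {tE} *.
  have [E Ediag FE] := Fdiag i h j (next_triple tE0).
  exact: (factor_unique tE0 Ediag FE (IHs _ _ tE0)).
move: Fsorted; rewrite tE0 map_cat => /cat_sorted2[_ /=].
by case/andP => /eqP.
Qed.

Lemma factors_exist : exists F : {ffun triple n -> Xi n d}, monomial_factors A
  F.
Proof.
(* The prefix before t is recovered from the index of t in the duplicate-free list [triples n]. On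
   this list the default A of [insubd] is never taken, by [factor_Xi]. *)
pose F : {ffun triple n -> Xi n d} :=
  [ffun t => insubd A (factor A (take (index t (triples n)) (triples n)) t)].
have FE s t s' : triples n = s ++ t :: s' -> Xi_mx (F t) = factor A s t.
  move=> tE; rewrite ffunE insubdK; last first.
    have := uniq_triples n; rewrite tE cat_uniq => /and3P[_ /norP[/= ts _] _].
    rewrite index_cat (negPf ts) /= eqxx addn0 take_size_cat //.
    exact: factor_Xi tE.
  have := uniq_triples n; rewrite tE cat_uniq => /and3P[_ /norP[/= ts _] _].
  by rewrite index_cat (negPf ts) /= eqxx addn0 take_size_cat.
exists F; split.
- move=> i h j jhi; have [s [s' tE]] : exists s s', triples n = s ++ (i, h, j)
  :: s'.
    have : (i, h, j) \in triples n by rewrite mem_triples.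
    by case/splitPr => s s'; exists s, s'.
  by rewrite (FE _ _ _ tE); exact: factor_decomposition tE.
- apply: sorted_consecutive => s1 B C s2 E.
  pose k := size s1.
  have E1 : [seq F t | t <- take k (triples n)] = s1.
    by rewrite map_take E take_size_cat.
  have E2 : [seq F t | t <- drop k (triples n)] = [:: B, C & s2].
    by rewrite map_drop E drop_size_cat.
  have tE := esym (cat_take_drop k (triples n)).
  move: E2; case: (drop k _) tE => [//|x [//|y s]] tE [<- <- _].
  rewrite (FE _ _ _ tE); rewrite -cat_rcons in tE.
  by rewrite (FE _ _ _ tE) (row_sums_factor tE) (@col_sums_factor _ _ (y :: s))
    // -cat_rcons.
- case tE : (triples n) => [//|t s] /=.
  rewrite (FE [::] t s tE) (@row_sums_factor [::] t s tE).
  by rewrite state0.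
- case/lastP tE : {-}(triples n) => [//|s t]; first by rewrite tE.
  rewrite tE map_rcons last_rcons; rewrite -cats1 in tE.
  rewrite (FE _ _ _ tE) (col_sums_factor tE) -cats1 -tE.
  exact: row_sums_state_triples.
Qed.

Lemma the_factorsP : monomial_factors A (the_factors A).
Proof. exact: classical_sets.xgetPex factors_exist. Qed.

End MonomialFactors.

(** * Chains of flags *)

Lemma sum_nat_gt0 (I : finType) (P : pred I) (f : I -> nat) :
  0 < \sum_(x | P x) f x -> exists2 x, P x & 0 < f x.
Proof.
rewrite lt0n sum_nat_eq0 negb_forall => /existsP[x].
by rewrite negb_imply -lt0n => /andP[]; exists x.
Qed.

Lemma sum_nat_le1 (I : finType) (P : pred I) (f : I -> nat) :
  (forall x y, P x -> P y -> 0 < f x -> 0 < f y -> x = y) ->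
  (forall x, P x -> f x <= 1) -> \sum_(x | P x) f x <= 1.
Proof.
move=> inj le1; case: (posnP (\sum_(x | P x) f x)) => [-> // | /sum_nat_gt0].
case=> x Px fx; rewrite (bigD1 x) //= big1 ?addn0 ?le1 // => y /andP[Py yx].
by case: (posnP (f y)) => // fy; rewrite (inj y x) ?eqxx in yx.
Qed.

Section Chains.
Variables (F : finFieldType) (n d : nat) (M : 'M[F]_(d.*2.+1)).
Local Notation N := (n.*2.+1).
Local Notation D := (d.*2.+1).
Implicit Types V W : flag_type F n d.

Fixpoint chains (s : seq (Xi n d)) V W : nat :=
  if s is B :: s' then \sum_(V' | orbit_rel M B V V') chains s' V' W
  else V == W.

Lemma chains_last s B V W : 0 < chains (rcons s B) V W ->
  exists2 V', V' \in flags n M & orbit_rel M B V' W.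
Proof.
elim: s V => [|C s IHs] V /= /sum_nat_gt0[V' VV'].
  rewrite lt0b => /eqP <-; exists V => //.
  by case/and3P: VV'.
exact: IHs.
Qed.

Definition dominates V W (B : 'M[nat]_N) :=
  forall k l, k <= N -> l <= N -> box B k l <= capr V W k l.

(** Enlarging U to U' enlarges its intersection with X by at most dim U' - dim U, since U + (U' cap
    X) lies in U'. *)
Lemma rank_cap_le (U U' X : 'M[F]_D) : (U <= U')%MS ->
  \rank (U' :&: X) + \rank U <= \rank (U :&: X) + \rank U'.
Proof.
move=> UU'; have := mxrank_sum_cap U (U' :&: X)%MS.
have -> : \rank (U :&: (U' :&: X))%MS = \rank (U :&: X)%MS.
  apply: eqmx_rank; rewrite capmxA; apply/eqmxP.
  by apply: cap_eqmx => //; apply/capmx_idPl.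
have : \rank (U + (U' :&: X))%MS <= \rank U'.
  by rewrite mxrankS // addsmx_sub UU' capmxSl.
lia.
Qed.

Section Duality.
Hypotheses (Msym : (M^T)%R = M) (Munit : M \in unitmx).

Section Dominates.
Variables (V W : flag_type F n d) (B : Xi n d).
Hypotheses (VX : V \in flags n M) (WX : W \in flags n M).

(** The bounds at k and N - k add up to D on both sides, so both are equalities. *)
Lemma dominates_rankl k : dominates V W B -> k <= N ->
  \rank (part V k) = box B k N.
Proof.
move=> dom kN; have := dom _ _ kN (leqnn N).
have := dom _ _ (leq_subr k N) (leqnn N).
rewrite !(caprN V WX); have := rank_part_dual Munit VX kN.
have := Xi_box_row_dual B kN; lia.
Qed.

Lemma dominates_rankr l : dominates V W B -> l <= N ->
  \rank (part W l) = box B N l.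
Proof.
move=> dom lN; have := dom _ _ (leqnn N) lN.
have := dom _ _ (leqnn N) (leq_subr l N).
rewrite !(capNr W VX); have := rank_part_dual Munit WX lN.
have := Xi_box_col_dual B lN; lia.
Qed.

(* Hence capr >= box at (k, l) is equivalent to capr >= box at (N - k, N - l).
  *)
Lemma capr_box_dual k l : k <= N -> l <= N ->
  \rank (part V k) = box B k N -> \rank (part W l) = box B N l ->
  capr V W (N - k) (N - l) + box B k l =
  box B (N - k) (N - l) + capr V W k l.
Proof.
move=> kN lN rV rW; have := capr_dual Msym Munit VX WX kN lN.
have := Xi_box_dual B kN lN; have := Xi_box_row_dual B kN.
have := Xi_box_col_dual B lN; lia.
Qed.
End Dominates.

(** * One step of a chain: bounds, equality case and uniqueness *)

Section Step.
Variables (A : Xi n d) (s s' : seq (triple n)) (i h j : 'I_N).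
Hypothesis tE : triples n = s ++ (i, h, j) :: s'.
Local Notation t := (i, h, j).
Variables V W : flag_type F n d.
Hypotheses (VX : V \in flags n M) (WX : W \in flags n M).
Let jhi : j <= h < i := next_triple tE.
Let tE' : triples n = rcons s t ++ s'. Proof. by rewrite cat_rcons. Qed.
Let iN : i < N := ltn_ord i.

Let B := MkXi (state_Xi A tE).
Let B' := MkXi (state_Xi A tE').

Section Next.
Variable V' : flag_type F n d.
Hypothesis V'X : V' \in flags n M.
Hypothesis VV' : rel_pos V V' = factor A s t.
Hypothesis dom : dominates V' W B'.

Let h1E : (inord h.+1 : 'I_N) = h.+1 :> nat := inord_next tE.
Let C0 (a b : 'I_N) (ab : a != b :> nat) n1 n2 : rel_pos V V' a b = 0 :=
  etrans (congr1 (fun R : 'M[nat]_N => R a b) VV')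
    (factor_offdiag0 A tE ab n1 n2).
Let Ca : rel_pos V V' (inord h.+1) h = A i j :=
  etrans (congr1 (fun R : 'M[nat]_N =>
    R (inord h.+1) h) VV') (factor_entry A tE).

Let step_eqE k (kN : k <= N) (k1 : k != h.+1) (k2 : k != N - h.+1) :
  part V' k = part V k := step_eq VX V'X h1E C0 kN k1 k2.

Let rankE : \rank (part V' h.+1) = \rank (part V h.+1) + A i j :=
  step_rank VX V'X h1E C0 Ca.

Let hsub : (part V h.+1 <= part V' h.+1)%MS.
Proof. by apply: (step_sub VX V'X h1E C0) => //; lia. Qed.

Let boxBN l : l <= N -> box B N l = box B' N l.
Proof. by move=> lN; rewrite /= (box_state_step_other A tE) //; lia. Qed.

Let rankVh : \rank (part V h.+1) = box B h.+1 N.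
Proof.
have := rankE; rewrite (dominates_rankl V'X WX dom) //= (box_state_step A tE).
by rewrite ltn_ord; lia.
Qed.

Let rankW l : l <= N -> \rank (part W l) = box B N l.
Proof. by move=> lN; rewrite boxBN // (dominates_rankr V'X WX dom). Qed.

Let cap_le l : capr V' W h.+1 l <= capr V W h.+1 l + A i j.
Proof. by have := rank_cap_le (part W l) hsub; rewrite rankE /capr; lia. Qed.

(** Only k = h + 1 and its mirror need an argument. For l <= j the corner sum already equals that of
    the first h rows after the step, and V'_h lies in V_h. For l > j both sides drop from V' to V,
    the corner sum by exactly [A i j] and the intersection by at most that. *)
Lemma step_dominates : dominates V W B.
Proof.
have main k l : k <= N -> l <= N -> k != N - h.+1 -> box B k l <= capr V W k l.
  move=> kN lN k2; have [kE|k1] := eqVneq k h.+1; last first.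
    rewrite /capr -(step_eqE kN k1 k2) /= -(box_state_step_other A tE) //.
    exact: dom.
  rewrite {}kE /=; have := box_state_step A tE l.
  have [lj|lj] := leqP l j => boxE.
    have sV : (part V' h <= part V h)%MS.
      by apply: (step_sup VX V'X h1E C0); lia.
    have := box_state_rcons_below A tE lj.
    have := dom (ltnW (ltn_ord h)) lN => /=.
    have : capr V' W h l <= capr V W h l by rewrite mxrankS // capmxS.
    have : capr V W h l <= capr V W h.+1 l.
      by apply: (capr_mono VX WX); lia.
    by lia.
  have := cap_le l; have := dom (ltn_ord h) lN => /=; lia.
(* The mirror index follows from k = h + 1 by duality, as N is odd and hence h + 1 differs from N -
   (h + 1). *)
move=> k l kN lN; have [kE|] := eqVneq k (N - h.+1); last exact: main.
have lE : l = N - (N - l) by rewrite subKn.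
have hN : h.+1 <= N by [].
have := capr_box_dual VX WX hN (leq_subr l N) rankVh (rankW (leq_subr l N)).
have : h.+1 != N - h.+1 by lia.
by move/(main _ _ hN (leq_subr l N)); rewrite kE -lE; lia.
Qed.

Hypothesis capE : forall k l, k <= N -> l <= N -> capr V W k l = box B k l.

(** The lower bound is [dom]. For k = h + 1 the upper bound comes from V'_(h+1) lying in V_(h+2)
    when l <= j, as row h + 1 is then empty in these columns, and from [cap_le] when l > j. *)
Lemma step_capr_eq k l : k <= N -> l <= N -> capr V' W k l = box B' k l.
Proof.
have main k' l' : k' <= N -> l' <= N -> k' != N - h.+1 ->
    capr V' W k' l' = box B' k' l'.
  move=> kN lN k2; have [kE|k1] := eqVneq k' h.+1; last first.
    rewrite /capr (step_eqE kN k1 k2) /= (box_state_step_other A tE) //.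
    exact: capE.
  rewrite {k' k2 kN}kE; have hN : h.+1 <= N by [].
  have := box_state_step A tE l'; have := dom hN lN.
  have [lj|lj] := leqP l' j => /= domE boxE.
    have : capr V' W h.+1 l' <= capr V W h.+2 l'.
      by rewrite mxrankS // capmxS // (step_supS VX V'X h1E C0).
    rewrite capE //=; last by lia.
    by rewrite (box_state_next A tE) ?ltnNge ?lj /=; lia.
  by have := cap_le l'; rewrite capE //= ; lia.
move=> kN lN; have [kE|] := eqVneq k (N - h.+1); last exact: main.
have lE : l = N - (N - l) by rewrite subKn.
have hN : h.+1 <= N by [].
have := capr_box_dual V'X WX hN (leq_subr l N) (dominates_rankl V'X WX dom hN)
  (dominates_rankr V'X WX dom (leq_subr l N)).
have : h.+1 != N - h.+1 by lia.
by move/(main _ _ hN (leq_subr l N)); rewrite kE -lE; lia.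
Qed.

(** Equal dimensions force V_(h+2) cap W_(j+1) into V'_(h+1). Its sum with V_(h+1) exceeds V_(h+1)
    by [A i j] dimensions, exactly as V'_(h+1) does. *)
Lemma step_part_eq :
  (part V' h.+1 == part V h.+1 + (part V h.+2 :&: part W j.+1))%MS.
Proof.
have hN : h.+1 <= N by [].
have sup := step_supS VX V'X h1E C0.
have capEq : capr V' W h.+1 j.+1 = capr V W h.+2 j.+1.
  rewrite step_capr_eq // capE //=; last by lia.
  by rewrite (box_state_step A tE) (box_state_next A tE).
have subV' : (part V h.+2 :&: part W j.+1 <= part V' h.+1)%MS.
  have capS := capmxS sup (submx_refl (part W j.+1)).
  move/eqP: capEq; rewrite /capr (mxrank_leqif_eq capS) => /andP[_ sub].
  exact: submx_trans sub (capmxSl _ _).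
have sumS : (part V h.+1 + (part V h.+2 :&: part W j.+1) <= part V' h.+1)%MS.
  by rewrite addsmx_sub hsub.
rewrite andbC -(mxrank_leqif_eq sumS) rankE.
have := mxrank_sum_cap (part V h.+1) (part V h.+2 :&: part W j.+1)%MS.
have -> : \rank (part V h.+1 :&: (part V h.+2 :&: part W j.+1))%MS
    = capr V W h.+1 j.+1.
  apply: eqmx_rank; rewrite capmxA; apply/eqmxP.
  apply: cap_eqmx => //; apply/capmx_idPl; apply: (part_mono VX); lia.
rewrite -/(capr V W h.+2 j.+1) !capE //=; try lia.
by rewrite (box_state_next A tE) // ltnSn; lia.
Qed.

End Next.

Lemma step_unique V1 V2 : V1 \in flags n M -> V2 \in flags n M ->
  rel_pos V V1 = factor A s t -> rel_pos V V2 = factor A s t ->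
  dominates V1 W B' -> dominates V2 W B' ->
  (forall k l, k <= N -> l <= N -> capr V W k l = box B k l) -> V1 = V2.
Proof.
move=> V1X V2X R1 R2 dom1 dom2 capE.
have h1E : (inord h.+1 : 'I_N) = h.+1 :> nat := inord_next tE.
have C0 V' : rel_pos V V' = factor A s t -> forall a b : 'I_N, a != b :> nat ->
    ~~ ((a == inord h.+1) && (b == h)) ->
    ~~ ((a == rev_ord (inord h.+1)) && (b == rev_ord h)) -> rel_pos V V' a b =
      0.
  by move=> -> a b; exact: (factor_offdiag0 A tE).
apply: (flag_eq_except V1X V2X (leq_subr h.+1 N)) => k kN k2.
have [->|k1] := eqVneq k h.+1; last first.
  rewrite (step_eq VX V1X h1E (C0 _ R1) kN k1 k2).
  by rewrite (step_eq VX V2X h1E (C0 _ R2) kN k1 k2).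
apply: (part_inj V1X V2X); apply/eqmxP.
have /eqmxP E1 := step_part_eq V1X R1 dom1 capE.
have /eqmxP E2 := step_part_eq V2X R2 dom2 capE.
exact: eqmx_trans E1 (eqmx_sym E2).
Qed.

End Step.

Section Monomial.
Variables (A : Xi n d) (Ft : {ffun triple n -> Xi n d}).
Hypothesis FtP : monomial_factors A Ft.
Variable W : flag_type F n d.
Hypothesis WX : W \in flags n M.
Hypothesis rankW : forall l, l <= N -> \rank (part W l) = box A N l.

(** Induction from the end of the chain. There V = W, all cells lie on the diagonal, and both sides
    are dim W_m for m the minimum of k and l; [step_dominates] then goes back one flag at a time. *)
Lemma chains_dominates s s' V : triples n = s ++ s' -> V \in flags n M ->
  0 < chains [seq Ft t | t <- s'] V W -> dominates V W (state A s).
Proof.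
elim: s' => [|t s' IHs'] in s V *.
  rewrite cats0 => <- _ /=; rewrite lt0b => /eqP-> k l kN lN.
  rewrite box_cell_count; try by [case: (@cell_col_placement n)|
    move=> a b; rewrite cur_triples].
  pose m := minn k l; have mN : m <= N by rewrite geq_min kN.
  have -> : capr W W k l = \rank (part W m).
    rewrite /m /minn; case: ltnP => kl; apply: eqmx_rank; apply/eqmxP.
      by apply/capmx_idPl; apply: (part_mono WX); lia.
    by apply/capmx_idPr; apply: (part_mono WX); lia.
  rewrite rankW // -[X in box X](cell_count_id A) box_cell_count; try by
    [case: (@cell_col_placement n)|case: (@cell_row_placement n)].
  apply: leq_sum => a _; apply: leq_sum => b _; rewrite cur_triples.
  by rewrite /cell_row ltn_ord /= leq_min.
move=> tE VX /= /sum_nat_gt0[V' /and3P[_ V'X /eqP VV'] VW].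
have tE' : triples n = rcons s t ++ s' by rewrite cat_rcons.
rewrite (factors_eq FtP tE) in VV'; case: t => -[i h] j in tE tE' VV' *.
have dom := IHs' _ _ tE' V'X VW.
by apply: (@step_dominates A s s' i h j tE V W VX WX V') => // k l; exact: dom.
Qed.

(** By [step_unique] at most one next flag can be completed to a chain, and [step_capr_eq] hands the
    equalities on to it. *)
Lemma chains_le1 s s' V : triples n = s ++ s' -> V \in flags n M ->
  (forall k l, k <= N -> l <= N -> capr V W k l = box (state A s) k l) ->
  chains [seq Ft t | t <- s'] V W <= 1.
Proof.
elim: s' => [|t s' IHs'] in s V *; first by move=> _ _ _ /=; case: eqP.
move=> tE VX capE /=.
have tE' : triples n = rcons s t ++ s' by rewrite cat_rcons.
have FE := factors_eq FtP tE.
have dom V' : V' \in flags n M -> 0 < chains [seq Ft t | t <- s'] V' W ->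
  dominates V' W (state A (rcons s t)) by exact: chains_dominates.
case: t => -[i h] j in tE tE' FE dom *.
apply: sum_nat_le1 => [V1 V2 | V'].
  case/and3P => _ V1X /eqP R1 /and3P[_ V2X /eqP R2] /(dom _ V1X) d1 /(dom _
    V2X) d2.
  rewrite FE in R1 R2.
  exact: (@step_unique A s s' i h j tE V W VX WX V1 V2 V1X V2X R1 R2 d1 d2
    capE).
case/and3P => _ V'X /eqP VV'; rewrite FE in VV'.
case: (posnP (chains [seq Ft t | t <- s'] V' W)) => [-> //|VW].
apply: (IHs' (rcons s (i, h, j)) V' tE' V'X) => k l kN lN.
exact: (@step_capr_eq A s s' i h j tE V W VX WX V' V'X VV' (dom _ V'X VW) capE
  k l kN lN).
Qed.

End Monomial.
End Duality.
End Chains.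

(** * Coordinate flags *)

Local Open Scope ring_scope.

Section CoordinateSubspaces.
Variables (F : fieldType) (m : nat).
Implicit Types S T : {set 'I_m}.

(** A generator of the span of the basis vectors in S, chosen idempotent so that inclusion in it is
    a fixed point equation ([coord_mx_sub]). *)
Definition coord_mx S : 'M[F]_m := diag_mx (\row_x (x \in S)%:R).

Lemma coord_mxI S T : coord_mx S *m coord_mx T = coord_mx (S :&: T).
Proof.
rewrite /coord_mx mulmx_diag; congr diag_mx; apply/rowP => x.
by rewrite !mxE inE -natrM mulnb.
Qed.

Lemma coord_mxT : coord_mx setT = 1%:M.
Proof.
by apply/matrixP => x y; rewrite !mxE inE.
Qed.

Lemma coord_mx0 : coord_mx set0 = 0.
Proof. by apply/matrixP => x y; rewrite !mxE inE mul0rn. Qed.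

Lemma coord_mxC S : coord_mx S + coord_mx (~: S) = 1%:M.
Proof.
rewrite -coord_mxT; apply/matrixP => x y; rewrite !mxE !inE -mulrnDl.
by case: (x \in S) => /=; rewrite ?addr0 ?add0r; case: (y \in S);
  rewrite ?addr0 ?add0r.
Qed.

Lemma coord_mx_sub p (u : 'M[F]_(p, m)) S :
  (u <= coord_mx S)%MS = (u *m coord_mx S == u).
Proof.
apply/idP/eqP => [/submxP[w ->]|<-]; last exact: submxMl.
by rewrite -mulmxA coord_mxI setIid.
Qed.

Lemma coord_mx_cap S T :
  (coord_mx S :&: coord_mx T :=: coord_mx (S :&: T))%MS.
Proof.
apply/eqmxP/andP; split.
  rewrite coord_mx_sub -coord_mxI mulmxA.
  have /eqP-> : (coord_mx S :&: coord_mx T)%MS *m coord_mx S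
      == (coord_mx S :&: coord_mx T)%MS by rewrite -coord_mx_sub capmxSl.
  by rewrite -coord_mx_sub capmxSr.
by rewrite sub_capmx !coord_mx_sub !coord_mxI setIAC setIid -setIA setIid !eqxx.
Qed.

Lemma coord_mx_mono S T : S \subset T -> (coord_mx S <= coord_mx T)%MS.
Proof. by move=> /setIidPl ST; rewrite coord_mx_sub coord_mxI ST. Qed.

Lemma rank_coord_mx S : \rank (coord_mx S) = #|S|.
Proof.
pose R : 'M[F]_(#|S|, m) := \matrix_(a, x) (enum_val a == x)%:R.
have RRT : R *m R^T = 1%:M.
  apply/matrixP => a b; rewrite !mxE (bigD1 (enum_val b)) //= !mxE eqxx mulr1.
  rewrite big1 ?addr0 ?(inj_eq enum_val_inj) // => x /negPf xb.
  by rewrite !mxE [enum_val b == x]eq_sym xb mulr0.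
have RTR : R^T *m R = coord_mx S.
  apply/matrixP => x y; rewrite !mxE; case: (boolP (x \in S)) => xS.
    rewrite (bigD1 (enum_rank_in xS x)) //= !mxE enum_rankK_in // eqxx mul1r.
    rewrite big1 ?addr0; last first.
      move=> a ax; rewrite !mxE; case: eqP => [E|_]; last by rewrite mul0r.
      by rewrite -(inj_eq enum_val_inj) enum_rankK_in // E eqxx in ax.
    by [].
  rewrite mul0rn; apply: big1 => a _; rewrite !mxE; case: eqP => [E|_];
    last by rewrite mul0r.
  by rewrite -E enum_valP in xS.
have /eqP fR : row_free R by apply/row_freeP; exists R^T.
rewrite -[RHS]fR; apply: eqmx_rank; apply/andP; split.
  by rewrite -RTR submxMl.
by rewrite coord_mx_sub -RTR mulmxA RRT mul1mx.
Qed.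

End CoordinateSubspaces.

Section CellLabelling.
Variables n d : nat.
Local Notation N := (n.*2.+1).
Local Notation D := (d.*2.+1).
Variable A : Xi n d.

(** Distributes the D basis vectors over the cells, [A i j] of them in cell (i, j), with an
    involution lifting the half-turn. *)
Lemma cell_labelling : exists (c : 'I_D -> 'I_N * 'I_N) (sigma : 'S_D),
  [/\ involutive sigma,
      forall x, c (sigma x) = (rev_ord (c x).1, rev_ord (c x).2)
    & forall i j, (\sum_x (c x == (i, j)) = A i j)%N].
Proof.
pose T := {p : 'I_N * 'I_N & 'I_(A p.1 p.2)}.
have sumT (G : 'I_N * 'I_N -> nat) :
    (\sum_(x : T) G (tag x) = \sum_p A p.1 p.2 * G p)%N.
  rewrite -(sig_big_dep xpredT (fun _ => xpredT) (fun p _ => G p)) /=.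
  by apply: eq_bigr => p _; rewrite sum_nat_const card_ord.
have cardT : #|{: T}| = D.
  rewrite -sum1_card (sumT (fun=> 1%N)) -(Xi_box_tot A) box_tot pair_bigA.
  by apply: eq_bigr => p _; rewrite muln1.
pose rev2 (p : 'I_N * 'I_N) := (rev_ord p.1, rev_ord p.2).
have rev2E p : A p.1 p.2 = A (rev2 p).1 (rev2 p).2 by rewrite Xi_sym.
(* The involution reflects the cell and keeps the number inside the cell, which makes sense by the
   symmetry of A. *)
pose tau (x : T) : T := Tagged _ (cast_ord (rev2E (tag x)) (tagged x)).
have eqT (x y : T) : tag x = tag y -> tagged x = tagged y :> nat -> x = y.
  case: x y => [p a] [q b] /= pq; case: q / pq b => b ab.
  by congr Tagged; apply/val_inj.
have tauK : involutive tau.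
  by move=> x; apply: eqT => //=; case: (tag x) => a b;
    rewrite /rev2 /= !rev_ordK.
pose f (x : 'I_D) : T := enum_val (cast_ord (esym cardT) x).
pose r (x : T) : 'I_D := cast_ord cardT (enum_rank x).
have fK : cancel f r by move=> x; rewrite /f /r enum_valK cast_ordKV.
have rK : cancel r f by move=> x; rewrite /f /r cast_ordK enum_rankK.
have sK : involutive (r \o tau \o f).
  by move=> x /=; rewrite rK tauK fK.
exists (tag \o f), (perm (inv_inj sK)); split.
- by move=> x; rewrite !permE.
- by move=> x; rewrite permE /= rK.
- move=> i j /=.
  rewrite -(reindex f (F := fun x =>
    ((tag x == (i, j)) : nat)) (P := xpredT)); last first.
    by apply: onW_bij; exists r.
  rewrite (sumT (fun p => ((p == (i, j)) : nat))) (bigD1 (i, j)) //= eqxx muln1.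
  by rewrite big1 ?addn0 // => p /negPf->; rewrite muln0.
Qed.

End CellLabelling.

Section CoordinateFlags.
Variables (F : finFieldType) (n d : nat).
Local Notation N := (n.*2.+1).
Local Notation D := (d.*2.+1).
Variables (A : Xi n d) (c : 'I_D -> 'I_N * 'I_N) (sigma : 'S_D).
Hypothesis sigmaK : involutive sigma.
Hypothesis c_sigma : forall x, c (sigma x) = (rev_ord (c x).1, rev_ord (c x).2).
Hypothesis card_c : forall i j, (\sum_x (c x == (i, j)) = A i j)%N.

Let M : 'M[F]_D := perm_mx sigma.

Lemma perm_mx_sym : M^T = M.
Proof.
rewrite /M tr_perm_mx; congr perm_mx; apply/permP => x.
by apply: (can_inj sigmaK); rewrite permKV sigmaK.
Qed.

Lemma perm_mx_coord S : M *m coord_mx F S = coord_mx F (sigma @^-1: S) *m M.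
Proof.
rewrite /M /coord_mx mul_diag_mx mul_mx_diag; apply/matrixP => x y.
by rewrite !mxE !inE mulrC; case: eqP => [<-|_]; rewrite ?mulr0.
Qed.

(** The basis vectors x and y pair to 1 if y = sigma x and to 0 otherwise, so x is orthogonal to S
    exactly when sigma x is not in S. *)
Lemma perp_coord S :
  (perp M (coord_mx F S) :=: coord_mx F (~: (sigma @^-1: S)))%MS.
Proof.
rewrite /perp (_ : (coord_mx F S)^T = coord_mx F S) ?tr_diag_mx //
  perm_mx_coord.
set S' := _ @^-1: S; apply/eqmxP/andP; split.
  set K := kermx _; have : K *m (coord_mx F S' *m M) = 0 by exact: mulmx_ker.
  move/(congr1 (mulmx^~ (invmx M)));
    rewrite mul0mx mulmxA mulmxK ?unitmx_perm // => K0.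
  rewrite coord_mx_sub -[X in _ == X]mulmx1 -(coord_mxC F S') mulmxDr K0.
  by rewrite add0r.
apply/sub_kermxP; rewrite mulmxA coord_mxI setIC setICr coord_mx0.
by rewrite mul0mx.
Qed.

Definition initial (f : 'I_N -> 'I_N -> nat) k : {set 'I_D} :=
  [set x | (f (c x).1 (c x).2 < k)%N].

Definition coord_flag f : flag_type F n d :=
  [ffun k : 'I_N.+1 => <<coord_mx F (initial f k)>>%MS].

Lemma part_coord_flag f k : (k <= N)%N ->
  (part (coord_flag f) k :=: coord_mx F (initial f k))%MS.
Proof. by move=> kN; rewrite /part ffunE inordK //; exact: genmxE. Qed.

Lemma initial_mono f k l : (k <= l)%N -> initial f k \subset initial f l.
Proof. by move=> kl; apply/subsetP => x; rewrite !inE => /leq_trans->. Qed.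

Lemma perp_eqmx U W : (U :=: W)%MS -> (perp M U :=: perp M W)%MS.
Proof.
have Msym := perm_mx_sym => UW; apply/eqmxP/andP.
by split; rewrite (perp_sub Msym); [rewrite -UW | rewrite UW];
   rewrite (perp_sub Msym).
Qed.

Lemma coord_flag_in f : placement f -> coord_flag f \in flags n M.
Proof.
move=> [fN fR]; rewrite inE; apply/and5P; split.
- by apply/forallP => k; rewrite ffunE genmx_id.
- rewrite ffunE (_ : initial f _ = set0) ?coord_mx0 ?genmx0 ?submx_refl //.
- rewrite ffunE (_ : initial f _ = setT) ?coord_mxT.
    by rewrite !genmxE submx_refl.
  by apply/setP => x; rewrite !inE /= fN.
- apply/forallP => k; rewrite !ffunE !genmxE coord_mx_mono //.
  by apply: initial_mono; rewrite lift0 /=.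
- apply/forallP => k; apply/eqmxP; rewrite !ffunE.
  apply: eqmx_trans (genmxE _) _; apply: eqmx_trans; last first.
    exact/eqmx_sym/perp_eqmx/genmxE.
  apply: eqmx_trans; last exact/eqmx_sym/perp_coord.
  suff -> : initial f k = ~: (sigma @^-1: initial f (rev_ord k)) by [].
  apply/setP => x; rewrite !inE c_sigma /= fR.
  by have := fN (c x).1 (c x).2; have := ltn_ord k; lia.
Qed.

Lemma rel_pos_coord_flag f g : placement f -> placement g ->
  rel_pos (coord_flag f) (coord_flag g) = cell_count A f g.
Proof.
move=> fP gP; apply: box_inj => k l kN lN.
rewrite (rel_pos_box (coord_flag_in fP) (coord_flag_in gP)) //.
rewrite box_cell_count; [|exact: fP.1|exact: gP.1].
rewrite /capr (cap_eqmx (part_coord_flag f kN) (part_coord_flag g lN)).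
rewrite coord_mx_cap rank_coord_mx -sum1_card big_mkcond /=.
rewrite pair_bigA /=; under [RHS]eq_bigr => p _ do rewrite -card_c big_distrl.
rewrite exchange_big; apply: eq_bigr => x _ /=.
rewrite (bigD1 (c x)) //= big1 ?addn0 => [|p pc]; last first.
  by rewrite -surjective_pairing eq_sym (negPf pc).
by rewrite -surjective_pairing eqxx mul1n !inE; case: (_ && _).
Qed.

Variable Ft : {ffun triple n -> Xi n d}.
Hypothesis FtP : monomial_factors A Ft.

(** The chain consists of the coordinate flags of the placements [cur s] for the successive prefixes
    s. *)
Lemma coord_chains_gt0 s s' : triples n = s ++ s' ->
  (0 < chains M [seq Ft t | t <- s'] (coord_flag (cur s)) (coord_flag
    (@cell_col n)))%N.
Proof.
elim: s' s => [|t s' IHs'] s tE /=.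
  rewrite lt0b; apply/eqP/ffunP => k; rewrite !ffunE; congr genmx;
    congr coord_mx.
  by apply/setP => x; rewrite !inE -[s]cats0 -tE cur_triples.
have tE' : triples n = rcons s t ++ s' by rewrite cat_rcons.
rewrite (bigD1 (coord_flag (cur (rcons s t)))) /=.
  by rewrite addn_gt0 IHs'.
apply/and3P; split.
- exact: coord_flag_in (cur_placement tE).
- exact: coord_flag_in (cur_placement tE').
rewrite (factors_eq FtP tE); apply/eqP.
exact: rel_pos_coord_flag (cur_placement tE) (cur_placement tE').
Qed.

Lemma rel_pos_rows_cols :
  rel_pos (coord_flag (@cell_row n)) (coord_flag (@cell_col n)) = A.
Proof.
rewrite rel_pos_coord_flag ?cell_count_id //.
  exact: cell_row_placement.
exact: cell_col_placement.
Qed.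

Lemma coord_flag_cur0 : coord_flag (cur [::]) = coord_flag (@cell_row n).
Proof.
apply/ffunP => k; rewrite !ffunE; congr genmx; congr coord_mx.
by apply/setP => x; rewrite !inE cur0.
Qed.

End CoordinateFlags.

Lemma realization (F : finFieldType) (n d : nat) (A : Xi n d)
    (Ft : {ffun triple n -> Xi n d}) : monomial_factors A Ft ->
  exists (M : 'M[F]_(d.*2.+1)) (V W : flag_type F n d),
  [/\ M^T = M, M \in unitmx, orbit_rel M A V W
    & (0 < chains M [seq Ft t | t <- triples n] V W)%N].
Proof.
move=> FtP; have [c [sigma [sK cs cc]]] := cell_labelling A.
exists (perm_mx sigma), (coord_flag F c (@cell_row n)), (coord_flag F c
  (@cell_col n)).
split.
- exact: perm_mx_sym.
- exact: unitmx_perm.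
- apply/and3P; split.
  + exact: coord_flag_in (@cell_row_placement n).
  + exact: coord_flag_in (@cell_col_placement n).
  + by apply/eqP; exact: rel_pos_rows_cols.
- rewrite -coord_flag_cur0;
  exact: (coord_chains_gt0 F sK cs cc FtP (erefl : triples n = [::] ++ triples
    n)).
Qed.

(** * Expansion of the monomial *)

Lemma odd_primes k : exists s : seq nat,
  [/\ size s = k, uniq s & all (fun p => prime p && odd p) s].
Proof.
elim: k => [|k [s [sk us ps]]]; first by exists [::].
(* Exceeding the sum makes p new, and exceeding 2 makes it odd. *)
have [p pgt pp] := prime_above (sumn s + 2).
exists (p :: s); split=> /=; first by rewrite sk.
  rewrite us andbT; apply/negP => ps'.
  suff : (p <= sumn s)%N by lia.
  by elim: s ps' {sk us ps pgt} => //= a s IHs;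
    rewrite inE => /predU1P[->|/IHs]; lia.
rewrite ps pp andbT /=; case: (even_prime pp) => // p2; move: pgt; lia.
Qed.

Lemma poly_eq0_odd_primes (P : {poly int}) :
  (forall p, prime p -> odd p -> P.[p%:R] = 0) -> P = 0.
Proof.
move=> P0; apply/eqP; apply: contraT => Pn0.
have [s [ss us ps]] := odd_primes (size P).
have := @max_poly_roots _ P [seq p%:R | p <- s] Pn0; rewrite size_map ss ltnn.
apply.
  apply/allP => _ /mapP[p /(allP ps)/andP[pp op] ->].
  by apply/rootP; exact: P0.
by rewrite map_inj_uniq // => a b /eqP; rewrite Num.Theory.eqr_nat => /eqP.
Qed.

Section Diagonal.
Variables (F : finFieldType) (n d : nat) (M : 'M[F]_(d.*2.+1)).
Local Notation N := (n.*2.+1).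
Variables V W : flag_type F n d.
Hypotheses (VX : V \in flags n M) (WX : W \in flags n M).

(** Shows that [Sj_one], the empty product, counts chains of length zero. *)
Lemma rel_pos_diag : is_diag_mx (rel_pos V W) = (V == W).
Proof.
apply/is_diag_mxP/eqP => [diag|<- i j ij].
  apply: (flag_eq VX WX) => k kN; apply: (part_inj VX WX); apply/andP; split.
    apply: (part_sub_rel_pos VX WX) => // i j ik kj; apply: diag.
    by lia.
  apply: (part_sup_rel_pos VX WX) => // i j ik kj; apply: diag.
  by lia.
have capE k l : (k <= l <= N)%N -> capr V V k l = \rank (part V k).
  move=> kl; apply: eqmx_rank; apply/eqmxP/capmx_idPl.
  exact: (part_mono VX).
have capE' k l : (l <= k <= N)%N -> capr V V k l = \rank (part V l).
  move=> kl; apply: eqmx_rank; apply/eqmxP/capmx_idPr.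
  exact: (part_mono VX).
have iN := ltn_ord i; have jN := ltn_ord j.
have := box_entry (rel_pos V V) i j; rewrite !(rel_pos_box VX VX) //;
  try exact: ltnW.
move: ij; rewrite neq_ltn => /orP[]/= ij.
  by rewrite !capE; lia.
by rewrite !capE'; lia.
Qed.

End Diagonal.

Section MonomialExpansion.
Variables (n d : nat) (g : Xi n d -> Xi n d -> Xi n d -> {poly int}).
Hypothesis g_struct : structure_polynomials g.
Local Notation N := (n.*2.+1).

Definition at_v2 (p : {poly int}) : laurent :=
  (map_poly intr p).[laurent_v ^+ 2].

Lemma at_v2M p q : at_v2 (p * q) = at_v2 p * at_v2 q.
Proof. by rewrite /at_v2 rmorphM hornerM. Qed.

Lemma at_v2_sum (I : finType) (p : I -> {poly int}) :
  at_v2 (\sum_i p i) = \sum_i at_v2 (p i).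
Proof. by rewrite /at_v2 rmorph_sum horner_sum. Qed.

Lemma at_v2_nat k : at_v2 k%:R = k%:R.
Proof. by rewrite /at_v2 rmorph_nat -polyC_natr hornerC. Qed.

Lemma Sj_scaleE (a : laurent) (x : Sj n d) C : (a *: x) C = a * x C.
Proof. by rewrite ffunE. Qed.

Lemma Sj_sumE (I : finType) (P : pred I) (x : I -> Sj n d) C :
  (\sum_(i | P i) x i) C = \sum_(i | P i) (x i C : laurent).
Proof. by rewrite sum_ffunE. Qed.

Lemma Sj_sum_e (a : Xi n d -> laurent) C :
  (\sum_A a A *: Sj_e A) C = a C.
Proof.
rewrite Sj_sumE (bigD1 C) //= Sj_scaleE ffunE eqxx mulr1 big1 ?addr0 // =>
  A neAC.
by rewrite Sj_scaleE ffunE eq_sym (negPf neAC) mulr0.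
Qed.

Lemma Sj_mul_std (B : Xi n d) (y : Sj n d) C :
  Sj_mul g (Sj_std B) y C =
  laurent_vV ^+ d_stat B * \sum_B' y B' * at_v2 (g B B' C).
Proof.
rewrite Sj_sumE (bigD1 B) //= [X in _ + X]big1 ?addr0; last first.
  move=> A AB; rewrite Sj_sumE big1 // => B' _.
  by rewrite Sj_scaleE Sj_scaleE ffunE (negPf AB) mulr0 !mul0r.
rewrite Sj_sumE big_distrr; apply: eq_bigr => B' _ /=.
by rewrite Sj_scaleE Sj_sum_e Sj_scaleE ffunE eqxx mulr1 mulrA.
Qed.

(** P is built from g by the recursion that counts chains by their second flag; the exponent e adds
    up the [d_stat] of the factors and does not depend on C. *)
Lemma std_product_chains (s : seq (Xi n d)) :
  exists (P : Xi n d -> {poly int}) (e : nat),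
  (forall C, (\big[Sj_mul g / Sj_one n d]_(B <- s) Sj_std B) C
             = laurent_vV ^+ e * at_v2 (P C)) /\
  (forall (F : finFieldType) (M : 'M[F]_(d.*2.+1)),
     odd #|F| -> M^T = M -> M \in unitmx ->
   forall (C : Xi n d) (V W : flag_type F n d), orbit_rel M C V W ->
     (P C).[#|F|%:R] = (chains M s V W)%:R).
Proof.
elim: s => [|B s [P [e [PE Pcount]]]].
  exists (fun C => (is_diag_mx (Xi_mx C))%:R), 0%N; split.
    move=> C; rewrite big_nil expr0 mul1r at_v2_nat Sj_sumE big_mkcond /=.
    rewrite (bigD1 C) //= ffunE eqxx big1 ?addr0; first by case: ifP.
    by move=> A neAC; rewrite ffunE eq_sym (negPf neAC) if_same.
  move=> F M _ _ _ C V W /and3P[VX WX /eqP <-] /=.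
  by rewrite (rel_pos_diag VX WX) -polyC_natr hornerC.
exists (fun C => \sum_B' P B' * g B B' C), (d_stat B + e)%N; split.
  move=> C; rewrite big_cons Sj_mul_std exprD -mulrA; congr (_ * _).
  rewrite at_v2_sum big_distrr; apply: eq_bigr => B' _ /=.
  by rewrite PE at_v2M mulrA.
move=> F M oF Msym Munit C V W VW /=; have /and3P[VX WX _] := VW.
rewrite horner_sum natr_sum.
under [LHS]eq_bigr => B' _.
  rewrite hornerM (g_struct B B' oF Msym Munit VW) -sum1_card natr_sum
    big_distrr /=.
  over.
rewrite (exchange_big_dep (fun V' => orbit_rel M B V V')) /=; last first.
  by move=> B' V' _; rewrite inE => /and3P[].
apply: eq_bigr => V' VV'; have V'X : V' \in flags n M by case/and3P: VV'.
(* Each V' is counted for exactly one B', the relative position of V' and W. *)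
pose B0 := MkXi (rel_pos_Xi Msym Munit V'X WX).
have V'W : orbit_rel M B0 V' W by rewrite /orbit_rel V'X WX eqxx.
rewrite (bigD1 B0) /=; last by rewrite inE V'X VV' V'W.
rewrite mulr1 (Pcount _ _ oF Msym Munit _ _ _ V'W) big1 ?addr0 // => B' /andP[].
rewrite inE => /and3P[_ _ /and3P[_ _ /eqP RB']] /eqP[].
exact/val_inj.
Qed.

Section Leading.
Hypothesis n_gt0 : (0 < n)%N.

(** For positive n there is a last factor, whose column sums fix the dimensions of the parts of W in
    [chains_rank_last]. *)
Lemma triples_rcons : exists s t, triples n = rcons s t.
Proof.
have : (inord 1, ord0, ord0) \in triples n by rewrite mem_triples /= inordK //;
  lia.
by case/lastP: (triples n) => // s t _; exists s, t.
Qed.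

Section OneMonomial.
Variables (A : Xi n d) (Ft : {ffun triple n -> Xi n d}).
Hypothesis FtP : monomial_factors A Ft.
Variables (F : finFieldType) (M : 'M[F]_(d.*2.+1)).

Lemma chains_rank_last (V W : flag_type F n d) l :
  (0 < chains M [seq Ft t | t <- triples n] V W)%N -> (l <= N)%N ->
  \rank (part W l) = box A N l.
Proof.
move=> + lN; have [_ _ _] := FtP; have [s [t ->]] := triples_rcons.
rewrite map_rcons last_rcons =>
  lastE /chains_last[V' V'X /and3P[_ WX /eqP V'W]].
rewrite -(capNr W V'X) -(rel_pos_box V'X WX) // V'W !box_col.
apply: eq_bigr => j _; have /matrixP/(_ j ord0) := lastE.
by rewrite !mxE.
Qed.

Hypotheses (Msym : M^T = M) (Munit : M \in unitmx).

Lemma chains_box_le (C : Xi n d) (V W : flag_type F n d) k l :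
  orbit_rel M C V W -> (0 < chains M [seq Ft t | t <- triples n] V W)%N ->
  (k <= N)%N -> (l <= N)%N -> (box A k l <= box C k l)%N.
Proof.
move=> /and3P[VX WX /eqP <-] VW kN lN; rewrite (rel_pos_box VX WX) //.
rewrite -[X in box X k l]state0.
apply: (chains_dominates Msym Munit FtP WX _ (s' := triples n)) => // l' l'N.
exact: (chains_rank_last VW l'N).
Qed.

Lemma chains_leading (V W : flag_type F n d) :
  orbit_rel M A V W -> (0 < chains M [seq Ft t | t <- triples n] V W)%N ->
  chains M [seq Ft t | t <- triples n] V W = 1%N.
Proof.
move=> /and3P[VX WX /eqP RA] VW; apply/eqP; rewrite eqn_leq VW andbT.
apply: (chains_le1 Msym Munit FtP WX _ (s := [::])) => // [l lN | k l kN lN].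
  exact: (chains_rank_last VW lN).
by rewrite state0 -(rel_pos_box VX WX) // RA.
Qed.

End OneMonomial.

Lemma monomial_triangular (A : Xi n d) :
  (exists u, u * monomial g A A = 1) /\
  (forall C, monomial g A C != 0 ->
     forall k l, (k <= N)%N -> (l <= N)%N -> (box A k l <= box C k l)%N).
Proof.
have [P [e [PE Pcount]]] :=
  std_product_chains [seq the_factors A t | t <- triples n].
have mE C : monomial g A C = laurent_vV ^+ e * at_v2 (P C).
  by rewrite -PE /monomial big_map.
have oddFp p (pp : prime p) : #|'F_p| = p by exact: card_Fp.
split.
  (* At each odd prime p, [realization] gives a pair in the orbit of A joined by a chain, and that
     chain is unique; so P A - 1 has infinitely many roots. *)
  have PA : P A = 1.
    apply/subr0_eq/poly_eq0_odd_primes => p pp op.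
    have [M [V [W [Msym Munit VW ch]]]] :=
      realization 'F_p (the_factorsP A).
    have oF : odd #|'F_p| by rewrite oddFp.
    have := Pcount _ _ oF Msym Munit _ _ _ VW.
    rewrite (chains_leading (the_factorsP A) Msym Munit VW ch) oddFp // => PA.
    by rewrite hornerD hornerN PA hornerC subrr.
  exists (laurent_v ^+ e); rewrite mE PA (at_v2_nat 1) mulr1 -exprMn laurent_vK.
  exact: expr1n.
move=> C mC k l kN lN; apply: contraNT mC; rewrite -ltnNge => lt.
(* If one corner sum of A exceeds that of C, no pair in the orbit of C is joined by a chain, over
   any F_p with p odd. *)
suff PC : P C = 0 by rewrite mE PC (at_v2_nat 0) mulr0.
apply: poly_eq0_odd_primes => p pp op.
have [M [V [W [Msym Munit VW _]]]] := realization 'F_p (the_factorsP C).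
have oF : odd #|'F_p| by rewrite oddFp.
have := Pcount _ _ oF Msym Munit _ _ _ VW; rewrite oddFp // => ->.
apply/eqP; rewrite Num.Theory.pnatr_eq0 -leqn0 leqNgt; apply: contraTN lt => ch.
rewrite -leqNgt.
exact: (chains_box_le (the_factorsP A) Msym Munit VW ch kN lN).
Qed.

End Leading.
End MonomialExpansion.

(** * Triangularity *)

Section BoxOrder.
Variables n d : nat.
Local Notation N := (n.*2.+1).
Implicit Types A C : Xi n d.

Definition box_le A C :=
  forall k l, (k <= N)%N -> (l <= N)%N -> (box A k l <= box C k l)%N.

Lemma box_le_row_sum A C (i : 'I_N) : box_le A C ->
  (\sum_j A i j = \sum_j C i j)%N.
Proof.
move=> leAC; have rowE k : (k <= N)%N -> box A k N = box C k N.
  move=> kN; have := leAC _ _ kN (leqnn N);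
    have := leAC _ _ (leq_subr k N) (leqnn N).
  have := Xi_box_row_dual A kN; have := Xi_box_row_dual C kN; lia.
have := rowE _ (ltn_ord i); rewrite !boxS (rowE _ (ltnW (ltn_ord i))).
have restrE (B : Xi n d) :
    (\sum_(j < N | (j < N)%N) B i j = \sum_j B i j)%N.
  by apply: eq_bigl => j; rewrite ltn_ord.
by move/addIn; rewrite !restrE.
Qed.

Lemma box_le_col_sum A C (j : 'I_N) : box_le A C ->
  (\sum_i A i j = \sum_i C i j)%N.
Proof.
move=> leAC; have colE l : (l <= N)%N -> box A N l = box C N l.
  move=> lN; have := leAC _ _ (leqnn N) lN;
    have := leAC _ _ (leqnn N) (leq_subr l N).
  have := Xi_box_col_dual A lN; have := Xi_box_col_dual C lN; lia.
have := colE _ (ltn_ord j); rewrite !box_col !sum_ord_ltS -!box_col.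
by rewrite (colE _ (ltnW (ltn_ord j))) => /addIn.
Qed.

(** A nonzero value away from the middle would occur twice and make the sum at least 2. *)
Lemma sum1_rev_mid (f : 'I_N -> nat) : (forall j, f (rev_ord j) = f j) ->
  (\sum_j f j = 1)%N -> forall j, f j = (j == mid n).
Proof.
move=> fR f1 j; have midE : mid n = n :> nat by rewrite /mid inordK //; lia.
have off i : i != mid n -> f i = 0%N.
  move=> im; apply/eqP; rewrite -leqn0 leqNgt; apply/negP => fi.
  have ri : rev_ord i != i.
    by move: im; rewrite -!val_eqE /= midE; have := ltn_ord i; lia.
  move: f1; rewrite (bigD1 i) //= (bigD1 (rev_ord i)) //= fR; lia.
have [->|] := eqVneq j (mid n); last exact: off.
by move: f1; rewrite (bigD1 (mid n)) //= big1 ?addn0.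
Qed.

(** Expresses membership through row and column sums, which are constant along [box_le]. *)
Lemma in_iXi A : (A \in iXi n d) =
  (\sum_j A (mid n) j == 1)%N && (\sum_i A i (mid n) == 1)%N.
Proof.
have rmid : rev_ord (mid n) = mid n.
  by apply/val_inj; rewrite /= /mid inordK; lia.
rewrite inE; apply/andP/andP => -[].
  move/eqP => A1 /forallP A0; split;
    rewrite (bigD1 (mid n)) //= A1 big1 // => i im.
    by have := A0 i; rewrite im => /andP[/eqP].
  by have := A0 i; rewrite im => /andP[_ /eqP].
move=> /eqP rA /eqP cA.
have rE : forall j, A (mid n) j = (j == mid n).
  by apply: sum1_rev_mid => // j; rewrite -[RHS]Xi_sym rmid.
have cE : forall i, A i (mid n) = (i == mid n).
  by apply: sum1_rev_mid => // i; rewrite -[RHS]Xi_sym rmid.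
split; first by rewrite rE eqxx.
by apply/forallP => i; apply/implyP => /negPf im; rewrite rE cE im.
Qed.

Lemma box_le_iXi A C : box_le A C -> A \in iXi n d -> C \in iXi n d.
Proof.
by move=> leAC; rewrite !in_iXi (box_le_row_sum _ leAC) (box_le_col_sum _ leAC).
Qed.

(** A numerical refinement of [box_le], on which the triangularity argument can induct. *)
Definition box_weight A := (\sum_(k < N.+1) \sum_(l < N.+1) box A k l)%N.

Lemma box_weight_lt A C : box_le A C -> C != A -> (box_weight A < box_weight
  C)%N.
Proof.
move=> leAC neAC; rewrite ltn_neqAle; apply/andP; split; last first.
  by apply: leq_sum => k _; apply: leq_sum => l _; rewrite leAC // -ltnS.
apply: contraNneq neAC => wE; apply/eqP/esym/Xi_box_inj => k l kN lN.
pose k' : 'I_N.+1 := Ordinal (kN : k < N.+1)%N.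
pose l' : 'I_N.+1 := Ordinal (lN : l < N.+1)%N.
apply/eqP; rewrite eqn_leq leAC //= leqNgt; apply/negP => lt.
suff : (box_weight A < box_weight C)%N by rewrite wE ltnn.
have le (a b : 'I_N.+1) : (box A a b <= box C a b)%N by rewrite leAC // -ltnS.
rewrite /box_weight (bigD1 k') // [X in (_ < X)%N](bigD1 k') //=.
rewrite (bigD1 l') // [X in (_ < X + _)%N](bigD1 l') //= -!addnA -addSn.
apply: leq_add => //; apply: leq_add; first by apply: leq_sum => b _;
  exact: (le k').
by apply: leq_sum => a _; apply: leq_sum => b _.
Qed.

End BoxOrder.

(** * A triangular family with invertible diagonal is a basis *)

Section TriangularBasis.
Variables n d : nat.
Variable P : {set Xi n d}.
Variables (w : Xi n d -> nat) (b : Xi n d -> Sj n d) (u : Xi n d -> laurent).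
Hypothesis b_unit : forall A, A \in P -> u A * b A A = 1.
Hypothesis b_supp : forall A C, A \in P -> b A C != 0 ->
  C \in P /\ (C != A -> (w A < w C)%N).

Definition supported (x : Sj n d) := forall C, C \notin P -> x C = 0.

Lemma supportedP (x : Sj n d) :
  supported x <-> exists c : Xi n d -> laurent, x = \sum_(A in P) c A *: Sj_e A.
Proof.
have E (c : Xi n d -> laurent) C :
    (\sum_(A in P) c A *: Sj_e A) C = if C \in P then c C else 0.
  rewrite Sj_sumE; case: ifP => CP.
    rewrite (bigD1 C) //= Sj_scaleE ffunE eqxx mulr1 big1 ?addr0 //.
    by move=> A /andP[_ neAC];
      rewrite Sj_scaleE ffunE eq_sym (negPf neAC) mulr0.
  apply: big1 => A inP; rewrite Sj_scaleE ffunE; case: eqP => [CA|_];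
    last by rewrite mulr0.
  by rewrite CA inP in CP.
split=> [x0|[c ->] C /negPf CP]; last by rewrite E CP.
by exists x; apply/ffunP => C; rewrite E; case: ifP => // /negbT /x0.
Qed.

Lemma b_supp0 A C : A \in P -> C != A -> (w C <= w A)%N -> b A C = 0.
Proof.
move=> inP neAC wCA; apply/eqP;
  apply: contraLR wCA => /(b_supp inP)[_ /(_ neAC)].
by rewrite -ltnNge.
Qed.

Lemma triangular_basis : basis_of_submodule P b supported.
Proof.
split.
- move=> A inP C CP; apply/eqP; apply: contraNT CP => bC.
  by have [] := b_supp inP bC.
- move=> c c0 A inP; apply/eqP; apply: contraT => cA.
  have : (A \in P) && (c A != 0) by rewrite inP.
  (* At an index B of least weight with nonzero coefficient, only [b B] contributes, and its
     diagonal entry is invertible. *)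
  case/(@arg_minnP _ A (fun A => (A \in P) && (c A != 0)) w) => B.
  case/andP=> BP /eqP cB Bmin; case: cB.
  have /ffunP/(_ B) := c0;
    rewrite Sj_sumE ffunE (bigD1 B) //= big1 => [|A' /andP[A'P neAB]].
    rewrite addr0 Sj_scaleE => cb.
    by rewrite -[c B]mulr1 -(b_unit BP) mulrCA cb mulr0.
  rewrite Sj_scaleE; case: (eqVneq (c A') 0) => [->|cA'];
    first by rewrite mul0r.
  rewrite b_supp0 ?mulr0 // 1?eq_sym //; apply: Bmin.
  by rewrite A'P.
(* Elimination by increasing weight: k counts the layers left below [mw], a bound above all weights,
   and no support remains when k = 0. *)
- move=> x xP; pose mw := (\max_A w A).+1.
  suff span k (y : Sj n d) : (forall C, y C != 0 -> C \in P /\ (mw <= w C +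
    k)%N) ->
      exists c : Xi n d -> laurent, y = \sum_(A in P) c A *: b A.
    have [C xC|c cE] := span mw x; last by exists c.
    split; last exact: leq_addl.
    by apply: contraNT xC => /xP ->.
  elim: k y {x xP} => [|k IHk] x xP.
    exists (fun=> 0); rewrite big1 => [|A _]; last by rewrite scale0r.
    apply/ffunP => C; rewrite ffunE; apply/eqP; apply: contraT => /xP[_].
    by rewrite addn0 /mw ltnNge (leq_bigmax C).
  (* These coefficients cancel the lowest layer of x and otherwise change only entries of larger
     weight. *)
  pose c0 A : laurent := if (w A + k.+1 == mw)%N then x A * u A else 0.
  have [|c cE] := IHk (x - \sum_(A in P) c0 A *: b A); last first.
    exists (fun A => c0 A + c A);
      rewrite -[LHS](subrK (\sum_(A in P) c0 A *: b A)).
    by rewrite cE addrC -big_split; apply: eq_bigr => A _; rewrite scalerDl.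
  have yE C : (x - \sum_(A in P) c0 A *: b A) C = x C - \sum_(A in P) c0 A * b
    A C.
    by rewrite !ffunE sum_ffunE; congr (_ - _); apply: eq_bigr => A _;
      rewrite ffunE.
  move=> C; rewrite yE => yC; apply/andP; apply: contraNT yC => nC.
  have [CP|CP] := boolP (C \in P); last first.
    rewrite big1 => [|A inP]; last first.
      rewrite (_ : b A C = 0) ?mulr0 //; apply/eqP; apply: contraNT CP.
      by case/(b_supp inP).
    by rewrite subr0; apply: contraNT CP => /xP[].
  move: nC; rewrite CP /= -ltnNge => wC.
  have c0b A : A \in P -> A != C -> c0 A * b A C = 0.
    move=> inP neAC; rewrite /c0; case: eqP => [wA|_]; last by rewrite mul0r.
    by rewrite b_supp0 ?mulr0 1?eq_sym //; lia.
  rewrite (bigD1 C) //= big1 => [|A /andP[]]; last exact: c0b.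
  rewrite addr0 /c0; case: ifP => [_|/eqP wCk].
    by rewrite -mulrA b_unit // mulr1 subrr.
  rewrite mul0r subr0; apply: contraT => /xP[_]; lia.
Qed.

End TriangularBasis.

Theorem proposition5p6 (n d : nat) (n_gt0 : (0 < n)%N) (d_gt0 : (0 < d)%N)
    (g : Xi n d -> Xi n d -> Xi n d -> {poly int})
    (g_struct : structure_polynomials g) :
  (forall A : Xi n d, A \in iXi n d -> Si (monomial g A)) /\
  basis_of_submodule (iXi n d) (monomial g) (@Si n d).
Proof.
have tri := monomial_triangular g_struct n_gt0.
(* Collects inverses of the diagonal coefficients, which are powers of v up to sign of the exponent,
   into one function. *)
have [u uE] := boolp.choice (fun A => (tri A).1).
have supp A C : A \in iXi n d -> monomial g A C != 0 ->
    C \in iXi n d /\ (C != A -> (box_weight A < box_weight C)%N).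
  move=> inP /((tri A).2 C) leAC; split; first exact: box_le_iXi leAC inP.
  exact: box_weight_lt.
have [mP free span] := triangular_basis (fun A _ => uE A) supp.
have mSi A : A \in iXi n d -> Si (monomial g A) by move=> /mP/supportedP.
by split=> //; split=> // x /supportedP/span.
Qed.
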